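(* Let $k$ be an algebraically closed field (of arbitrary characteristic), $G$ a linearly reductive linear algebraic group over $k$, $X$ an irreducible affine $G$-variety, and $W$ a $G$-module. The following are equivalent: (1) There is a non-zero relative invariant $f\in k[X]$ such that $G_x$ acts trivially on $W$ for all $x\in X_f$. (2) There is a non-zero relative invariant $f\in k[X]$ and an $x\in X_f$ whose $G$-orbit is closed in $X_f$, and $G_x$ acts trivially on $W$. (3) There is a non-zero relative invariant $f\in k[X]$ such that there are $d:=\dim(W)$ covariants $F_i:X_f\to W$ $(i=1,\ldots,d)$ with $F_1(x),\ldots,F_d(x)$ linearly independent for all $x\in X_f$. (4) There is a non-zero relative invariant $f\in k[X]$ such that the $G$-varieties $X_f\times W$ and $X_f\times k^{\dim(W)}$ are isomorphic.
   Context: A $G$-variety is an algebraic variety with a $G$-action whose action map is a morphism of varieties; products of $G$-varieties carry the diagonal action, and two $G$-varieties are isomorphic if there is a $G$-equivariant isomorphism of varieties between them. A $G$-module is a $G$-variety which is a finite dimensional $k$-vector space on which $G$ acts by linear transformations. For a non-negative integer $d$, $k^d$ denotes the $d$-dimensional vector space endowed with the trivial $G$-action. $k[X]$ is the ring of regular functions on $X$. An element $f\in k[X]$ is a relative invariant if $g\cdot f=\theta(g)f$ for all $g\in G$, for some character $\theta:G\to k^{\times}$. $X_f=\{x\in X\mid f(x)\neq 0\}$, which is a $G$-stable open subset of $X$ when $f$ is a relative invariant. $G_x$ is the stabilizer of $x$ in $G$. A covariant is a $G$-equivariant morphism of varieties from a $G$-variety to a $G$-module.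
   Formalization: The stabilizer G_x is taken scheme-theoretically (the fibre of the orbit map); as a group of points the claim fails in characteristic p (GL_1 on k by t^p, W of weight 1), and in characteristic 0 the two notions agree by Cartier's theorem. *)

(* Defs.v *)
From HB Require Import structures.
From mathcomp Require Import all_boot all_order all_algebra.
From mathcomp Require Import mpoly.

Set Implicit Arguments.
Unset Strict Implicit.
Unset Printing Implicit Defensive.

Import GRing.Theory.
Local Open Scope ring_scope.

(* Every variety occurring in the statement is affine, so a
   variety is a type of points put in bijection, by finitely many coordinate
   functions, with a Zariski closed subset of k^n; here [acoord_closed] says
   that the image contains every common zero of the polynomials vanishing on
   it.  The embedding only serves to define the regular functions: morphisms
   need not respect it. *)
Record affStructure (k : closedFieldType) (T : Type) := AffStructure {
  adim : nat;
  acoord : T -> 'I_adim -> k;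
  acoord_inj : forall x y, acoord x =1 acoord y -> x = y;
  acoord_closed : forall v : 'I_adim -> k,
    (forall p : {mpoly k[adim]}, (forall x, p.@[acoord x] = 0) -> p.@[v] = 0) ->
    exists x, acoord x =1 v
}.

Arguments acoord {k T} a x i.

Record affVariety (k : closedFieldType) := AffVariety {
  points :> Type;
  aff_structure : affStructure k points
}.

Definition point_coord (k : closedFieldType) (X : affVariety k) :
  X -> 'I_(adim (aff_structure X)) -> k := acoord (aff_structure X).

Definition regular (k : closedFieldType) (X : affVariety k) (f : X -> k) : Prop :=
  exists p : {mpoly k[adim (aff_structure X)]}, forall x, f x = p.@[point_coord x].

Definition morphism (k : closedFieldType) (X Y : affVariety k) (phi : X -> Y) :
  Prop := forall h : Y -> k, regular h -> regular (fun x => h (phi x)).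

Definition zariski_closed (k : closedFieldType) (X : affVariety k)
    (Z : X -> Prop) : Prop :=
  exists S : (X -> k) -> Prop,
    (forall h, S h -> regular h) /\
    (forall x, Z x <-> (forall h, S h -> h x = 0)).

Definition irreducible (k : closedFieldType) (X : affVariety k) : Prop :=
  (exists x : X, True) /\
  forall Z1 Z2 : X -> Prop, zariski_closed Z1 -> zariski_closed Z2 ->
    (forall x, Z1 x \/ Z2 x) -> (forall x, Z1 x) \/ (forall x, Z2 x).

Section RegularFunctions.
Variables (k : closedFieldType) (X : affVariety k).

Lemma eq_regular (f g : X -> k) : f =1 g -> regular f -> regular g.
Proof. by move=> fg [p pE]; exists p => x; rewrite -fg. Qed.

Lemma regular_cst (c : k) : regular (fun _ : X => c).
Proof. by exists c%:MP => x; rewrite mevalC. Qed.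

Lemma regularM (f g : X -> k) :
  regular f -> regular g -> regular (fun x => f x * g x).
Proof. by move=> [p pE] [q qE]; exists (p * q) => x; rewrite mevalM pE qE. Qed.

Lemma regular_coord i : regular (fun x : X => point_coord x i).
Proof. by exists 'X_i => x; rewrite mevalXU. Qed.

Lemma regular_meval n (p : {mpoly k[n]}) (f : 'I_n -> X -> k) :
  (forall i, regular (f i)) -> regular (fun x => p.@[fun i => f i x]).
Proof.
move=> reg_f.
have [q qE] := fin_all_exists reg_f.
exists (p \mPo [tuple q i | i < n]) => x; rewrite comp_mpoly_meval.
by apply: meval_eq => i; rewrite tnth_mktuple qE.
Qed.

End RegularFunctions.

Lemma coord_morphism (k : closedFieldType) (X Y : affVariety k) (phi : X -> Y) :
  (forall i, regular (fun x => point_coord (phi x) i)) -> morphism phi.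
Proof.
move=> reg_phi h [p pE].
by apply: eq_regular (regular_meval p reg_phi) => x; rewrite pE.
Qed.

Section Product.
Variables (k : closedFieldType) (X Y : affVariety k).
Let m := adim (aff_structure X).
Let n := adim (aff_structure Y).

Definition prod_coord (z : X * Y) (i : 'I_(m + n)) : k :=
  match split i with inl j => point_coord z.1 j | inr j => point_coord z.2 j end.

Let prod_coordl z j : prod_coord z (lshift n j) = point_coord z.1 j.
Proof. by rewrite /prod_coord (unsplitK (inl j)). Qed.

Let prod_coordr z j : prod_coord z (rshift m j) = point_coord z.2 j.
Proof. by rewrite /prod_coord (unsplitK (inr j)). Qed.

Fact prod_coord_inj z1 z2 : prod_coord z1 =1 prod_coord z2 -> z1 = z2.
Proof.
case: z1 z2 => [x1 y1] [x2 y2] E; congr pair.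
  by apply: acoord_inj => j; have:= E (lshift n j); rewrite !prod_coordl.
by apply: acoord_inj => j; have:= E (rshift m j); rewrite !prod_coordr.
Qed.

Fact prod_coord_closed (v : 'I_(m + n) -> k) :
  (forall p : {mpoly k[m + n]},
     (forall z, p.@[prod_coord z] = 0) -> p.@[v] = 0) ->
  exists z, prod_coord z =1 v.
Proof.
move=> vP.
have [x xE] : exists x : X, point_coord x =1 (fun j => v (lshift n j)).
  apply: acoord_closed => p p0.
  have := vP (p \mPo [tuple 'X_(lshift n j) | j < m]).
  rewrite comp_mpoly_meval.
  under meval_eq => i do rewrite tnth_mktuple mevalXU.
  apply=> z; rewrite comp_mpoly_meval -(p0 z.1).
  by apply: meval_eq => i; rewrite tnth_mktuple mevalXU prod_coordl.
have [y yE] : exists y : Y, point_coord y =1 (fun j => v (rshift m j)).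
  apply: acoord_closed => p p0.
  have := vP (p \mPo [tuple 'X_(rshift m j) | j < n]).
  rewrite comp_mpoly_meval.
  under meval_eq => i do rewrite tnth_mktuple mevalXU.
  apply=> z; rewrite comp_mpoly_meval -(p0 z.2).
  by apply: meval_eq => i; rewrite tnth_mktuple mevalXU prod_coordr.
exists (x, y) => i; rewrite -(splitK i).
by case: (split i) => j; rewrite /= ?prod_coordl ?prod_coordr.
Qed.

Definition prodVariety : affVariety k :=
  AffVariety (AffStructure prod_coord_inj prod_coord_closed).

Lemma fst_morphism : morphism (fst : prodVariety -> X).
Proof.
apply: coord_morphism => i; exists 'X_(lshift n i) => z.
by rewrite mevalXU; apply: esym; exact: prod_coordl.
Qed.

Lemma snd_morphism : morphism (snd : prodVariety -> Y).
Proof.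
apply: coord_morphism => i; exists 'X_(rshift m i) => z.
by rewrite mevalXU; apply: esym; exact: prod_coordr.
Qed.

Lemma pair_morphism (Z : affVariety k) (phi : Z -> X) (psi : Z -> Y) :
  morphism phi -> morphism psi ->
  morphism (fun z => (phi z, psi z) : prodVariety).
Proof.
move=> mphi mpsi; apply: coord_morphism => i; rewrite -(splitK i).
case: (split i) => j.
  by apply: eq_regular (mphi _ (regular_coord j)) => z; apply: esym; exact: prod_coordl.
by apply: eq_regular (mpsi _ (regular_coord j)) => z; apply: esym; exact: prod_coordr.
Qed.

End Product.

(* The principal open subset X_f, with coordinates (x, 1 / f x). *)
Section PrincipalOpen.
Variables (k : closedFieldType) (X : affVariety k) (f : X -> k).
Hypothesis reg_f : regular f.
Let n := adim (aff_structure X).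

Definition open_coord (x : {x : X | f x != 0}) (i : 'I_(n + 1)) : k :=
  match split i with inl j => point_coord (sval x) j | inr _ => (f (sval x))^-1 end.

Let open_coordl x j : open_coord x (lshift 1 j) = point_coord (sval x) j.
Proof. by rewrite /open_coord (unsplitK (inl j)). Qed.

Let open_coordr x j : open_coord x (rshift n j) = (f (sval x))^-1.
Proof. by rewrite /open_coord (unsplitK (inr j)). Qed.

Fact open_coord_inj x y : open_coord x =1 open_coord y -> x = y.
Proof.
move=> E; apply: val_inj; apply: acoord_inj => j.
by have:= E (lshift 1 j); rewrite !open_coordl.
Qed.

Fact open_coord_closed (v : 'I_(n + 1) -> k) :
  (forall p : {mpoly k[n + 1]},
     (forall x, p.@[open_coord x] = 0) -> p.@[v] = 0) ->
  exists x, open_coord x =1 v.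
Proof.
move=> vP; have [q qE] := reg_f.
have lift_meval (p : {mpoly k[n]}) (w : 'I_(n + 1) -> k) :
    (p \mPo [tuple 'X_(lshift 1 j) | j < n]).@[w]
      = p.@[fun j => w (lshift 1 j)].
  rewrite comp_mpoly_meval.
  by apply: meval_eq => i; rewrite tnth_mktuple mevalXU.
have [x xE] : exists x : X, point_coord x =1 (fun j => v (lshift 1 j)).
  apply: acoord_closed => p p0.
  rewrite -lift_meval; apply: vP => z; rewrite lift_meval -(p0 (sval z)).
  by apply: meval_eq => i; rewrite open_coordl.
have fv : f x * v (rshift n ord0) = 1.
  apply/eqP; rewrite -subr_eq0; apply/eqP.
  have := vP ((q \mPo [tuple 'X_(lshift 1 j) | j < n]) * 'X_(rshift n ord0) - 1).
  rewrite mevalB mevalM meval1 mevalXU lift_meval qE (meval_eq _ xE).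
  apply=> z; rewrite mevalB mevalM meval1 mevalXU lift_meval open_coordr.
  rewrite (meval_eq _ (open_coordl z)) -qE divff ?subrr //.
  exact: (svalP z).
have fx : f x != 0.
  by apply: contra_eq_neq fv => ->; rewrite mul0r eq_sym oner_neq0.
exists (exist _ x fx) => i; rewrite -(splitK i).
case: (split i) => j; rewrite /= ?open_coordl ?open_coordr //= ord1.
by rewrite -[LHS]mulr1 -fv mulKf.
Qed.

Definition openVariety : affVariety k :=
  AffVariety (AffStructure open_coord_inj open_coord_closed).

Lemma sval_morphism : morphism (fun x : openVariety => sval x).
Proof.
apply: coord_morphism => i; exists 'X_(lshift 1 i) => z.
by rewrite mevalXU; apply: esym; exact: open_coordl.
Qed.

Lemma regular_invf : regular (fun x : openVariety => (f (sval x))^-1).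
Proof.
exists 'X_(rshift n ord0) => z.
by rewrite mevalXU; apply: esym; exact: open_coordr.
Qed.

Lemma to_open_morphism (Y : affVariety k) (phi : Y -> openVariety) :
  morphism (fun y => sval (phi y)) ->
  regular (fun y => (f (sval (phi y)))^-1) -> morphism phi.
Proof.
move=> mphi rphi; apply: coord_morphism => i; rewrite -(splitK i).
case: (split i) => j.
  by apply: eq_regular (mphi _ (regular_coord j)) => z; apply: esym; exact: open_coordl.
by apply: eq_regular rphi => z; apply: esym; exact: open_coordr.
Qed.

End PrincipalOpen.

Section VectorSpace.
Variables (k : closedFieldType) (V : vectType k).

Definition vect_coord (v : V) (i : 'I_(\dim {:V})) : k :=
  coord (vbasis {:V}) i v.

Fact vect_coord_inj u v : vect_coord u =1 vect_coord v -> u = v.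
Proof.
move=> E; rewrite (coord_vbasis (memvf u)) (coord_vbasis (memvf v)).
by apply: eq_bigr => i _; congr (_ *: _); apply: E.
Qed.

Fact vect_coord_closed (w : 'I_(\dim {:V}) -> k) :
  (forall p : {mpoly k[\dim {:V}]},
     (forall v, p.@[vect_coord v] = 0) -> p.@[w] = 0) ->
  exists v, vect_coord v =1 w.
Proof.
move=> _; exists (\sum_i w i *: (vbasis {:V})`_i) => i.
exact: coord_sum_free (basis_free (vbasisP _)).
Qed.

Definition vectVariety : affVariety k :=
  AffVariety (AffStructure vect_coord_inj vect_coord_closed).

End VectorSpace.

(* Over k, a linear algebraic group is an affine variety with a group
   structure whose operations are morphisms. *)
Record algGroup (k : closedFieldType) := AlgGroup {
  grp :> groupType;
  grp_structure : affStructure k grp;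
  group_variety := AffVariety grp_structure;
  mulg_morphism :
    @morphism k (prodVariety group_variety group_variety) group_variety
      (fun gh => (gh.1 * gh.2)%g);
  invg_morphism :
    @morphism k group_variety group_variety (fun g => (g^-1)%g)
}.

Record gAction (k : closedFieldType) (G : algGroup k) (X : affVariety k) :=
  GAction {
    gact : G -> X -> X;
    gact1 : forall x, gact 1%g x = x;
    gactM : forall g h x, gact (g * h)%g x = gact g (gact h x);
    gact_morphism :
      @morphism k (prodVariety (group_variety G) X) X (fun gx => gact gx.1 gx.2)
  }.

Record gVariety (k : closedFieldType) (G : algGroup k) := GVariety {
  gvariety :> affVariety k;
  gaction : gAction G gvariety
}.

Definition act (k : closedFieldType) (G : algGroup k) (X : gVariety G) :
  G -> X -> X := gact (gaction X).

Record gModule (k : closedFieldType) (G : algGroup k) := GModule {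
  gm_vect :> vectType k;
  gm_action : gAction G (vectVariety gm_vect);
  gm_linear : forall g : G, linear (gact gm_action g : gm_vect -> gm_vect)
}.

Definition module_gvariety (k : closedFieldType) (G : algGroup k)
  (W : gModule G) : gVariety G := GVariety (gm_action W).

Definition equivariant (k : closedFieldType) (G : algGroup k)
    (X Y : gVariety G) (phi : X -> Y) : Prop :=
  forall (g : G) (x : X), phi (act g x) = act g (phi x).

Definition gisomorphic (k : closedFieldType) (G : algGroup k)
    (X Y : gVariety G) : Prop :=
  exists (phi : X -> Y) (psi : Y -> X),
    [/\ cancel phi psi, cancel psi phi, morphism phi, morphism psi
      & equivariant phi].

Definition covariant (k : closedFieldType) (G : algGroup k) (X : gVariety G)
    (W : gModule G) (F : X -> W) : Prop :=
  @morphism k X (module_gvariety W) F /\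
  @equivariant k G X (module_gvariety W) F.

Definition linearly_reductive (k : closedFieldType) (G : algGroup k) : Prop :=
  forall (W : gModule G) (U : {vspace W}),
    (forall (g : G) w, w \in U -> gact (gm_action W) g w \in U) ->
    exists U' : {vspace W},
      [/\ forall (g : G) w, w \in U' -> gact (gm_action W) g w \in U',
          (U + U' = fullv)%VS & (U :&: U' = 0)%VS].

Definition is_character (k : closedFieldType) (G : algGroup k) (theta : G -> k) :
  Prop :=
  [/\ @regular k (group_variety G) theta, forall g : G, theta g != 0
    & forall g h : G, theta (g * h)%g = theta g * theta h].

(* The group acts on functions by (g . f) x = f (g^-1 x). *)
Record relInvariant (k : closedFieldType) (G : algGroup k) (X : gVariety G) :=
  RelInvariant {
    relinv :> X -> k;
    relinv_regular : regular relinv;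
    relinv_character : exists theta : G -> k, is_character theta /\
      forall (g : G) (x : X), relinv (act g^-1%g x) = theta g * relinv x
  }.

Definition nonzero_fun (k : closedFieldType) (X : affVariety k) (f : X -> k) :
  Prop := exists x, f x != 0.

Section TrivialModule.
Variables (k : closedFieldType) (G : algGroup k) (d : nat).
Let V : vectType k := 'rV[k]_d.

Fact triv_morphism :
  @morphism k (prodVariety (group_variety G) (vectVariety V)) (vectVariety V)
    (fun gx => gx.2).
Proof. exact: snd_morphism. Qed.

Definition triv_action : gAction G (vectVariety V) :=
  @GAction k G (vectVariety V) (fun _ v => v)
    (fun _ => erefl) (fun _ _ _ => erefl) triv_morphism.

Fact triv_linear (g : G) : linear (gact triv_action g : V -> V).
Proof. by []. Qed.

Definition trivModule : gModule G := GModule triv_linear.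

End TrivialModule.

Section ProductAction.
Variables (k : closedFieldType) (G : algGroup k) (X Y : gVariety G).

Definition prod_act (g : G) (z : prodVariety X Y) : prodVariety X Y :=
  (act g z.1, act g z.2).

Fact prod_act1 z : prod_act 1%g z = z.
Proof. by case: z => x y; rewrite /prod_act /act !gact1. Qed.

Fact prod_actM g h z : prod_act (g * h)%g z = prod_act g (prod_act h z).
Proof. by rewrite /prod_act /act !gactM. Qed.

Fact prod_act_morphism :
  @morphism k (prodVariety (group_variety G) (prodVariety X Y)) (prodVariety X Y)
    (fun gz => prod_act gz.1 gz.2).
Proof.
have m1 := @fst_morphism k (group_variety G) (prodVariety X Y).
have m2 := @snd_morphism k (group_variety G) (prodVariety X Y).
apply: pair_morphism => h reg_h.
  have mp : @morphism k _ (prodVariety (group_variety G) X)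
      (fun gz : prodVariety (group_variety G) (prodVariety X Y) => (gz.1, gz.2.1)).
    apply: pair_morphism => // u /(@fst_morphism k X Y); exact: m2.
  exact: mp (gact_morphism (gaction X) reg_h).
have mp : @morphism k _ (prodVariety (group_variety G) Y)
    (fun gz : prodVariety (group_variety G) (prodVariety X Y) => (gz.1, gz.2.2)).
  apply: pair_morphism => // u /(@snd_morphism k X Y); exact: m2.
exact: mp (gact_morphism (gaction Y) reg_h).
Qed.

Definition prodGVariety : gVariety G :=
  GVariety (GAction prod_act1 prod_actM prod_act_morphism).

End ProductAction.

Section OpenAction.
Variables (k : closedFieldType) (G : algGroup k) (X : gVariety G).
Variable f : relInvariant X.
Let Xf := openVariety (relinv_regular f).

Fact open_stable (g : G) (x : X) : f x != 0 -> f (act g x) != 0.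
Proof.
move=> fx; have [theta [[_ nz _] fE]] := relinv_character f.
by have:= fE g^-1%g x; rewrite invgK => ->; rewrite mulf_neq0.
Qed.

Definition open_act (g : G) (x : Xf) : Xf :=
  exist _ (act g (sval x)) (open_stable g (svalP x)).

Fact open_act1 x : open_act 1%g x = x.
Proof. by apply: val_inj; apply: gact1. Qed.

Fact open_actM g h x : open_act (g * h)%g x = open_act g (open_act h x).
Proof. by apply: val_inj; apply: gactM. Qed.

Fact open_act_morphism :
  @morphism k (prodVariety (group_variety G) Xf) Xf (fun gx => open_act gx.1 gx.2).
Proof.
have m1 := @fst_morphism k (group_variety G) Xf.
have m2 := @snd_morphism k (group_variety G) Xf.
apply: to_open_morphism => /=.
  move=> h reg_h.
  have mp : @morphism k _ (prodVariety (group_variety G) X)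
      (fun gz : prodVariety (group_variety G) Xf => (gz.1, sval gz.2)).
    apply: pair_morphism => // u /(sval_morphism (relinv_regular f)).
    exact: m2.
  exact: mp (gact_morphism (gaction X) reg_h).
have [theta [[reg_th nz thM] fE]] := relinv_character f.
have thinv g x : f x != 0 -> (f (act g x))^-1 = theta g * (f x)^-1.
  move=> fx; have := fE g (act g x); rewrite /act -gactM mulVg gact1 => ->.
  rewrite invfM mulrA divff ?mul1r ?nz //.
apply: eq_regular (regularM (m1 _ reg_th)
  (m2 _ (regular_invf (relinv_regular f)))) => gx.
by rewrite thinv //; apply: (svalP gx.2).
Qed.

Definition openGVariety : gVariety G :=
  GVariety (GAction open_act1 open_actM open_act_morphism).

Definition open_incl (x : openGVariety) : X := sval (x : Xf).

End OpenAction.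

Definition gorbit (k : closedFieldType) (G : algGroup k) (X : gVariety G) (x : X)
  : X -> Prop := fun y => exists g : G, y = act g x.

(* In positive characteristic the fibre over x of the orbit map g |-> g x need
   not be reduced, so the stabilizer of x is taken as a closed subscheme of G.
   It is given by its ideal in k[G], generated by the functions
   g |-> h (g x) - h x with h in k[X].  In characteristic 0 this ideal is
   radical, and the stabilizer is the usual group of points. *)
Definition stabilizer_ideal (k : closedFieldType) (G : algGroup k)
    (X : gVariety G) (x : X) (phi : G -> k) : Prop :=
  exists (n : nat) (a : 'I_n -> group_variety G -> k) (h : 'I_n -> X -> k),
    [/\ forall i, regular (a i), forall i, regular (h i)
      & forall g : G, phi g = \sum_(i < n) a i g * (h i (act g x) - h i x)].

(* G_x acts trivially on W: for all w, the two morphisms g |-> g w and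
   g |-> w from G_x to W coincide.  For G = GL_1 acting on X = k by
   t . x = t^p x in characteristic p, and on W = k with weight 1, G_x is mu_p
   for x != 0; it acts nontrivially on W although it has only one point, and
   there is no nonzero covariant X_f -> W. *)
Definition stabilizer_acts_trivially (k : closedFieldType) (G : algGroup k)
    (X : gVariety G) (x : X) (W : gModule G) : Prop :=
  forall (w : module_gvariety W) (h : module_gvariety W -> k), regular h ->
    stabilizer_ideal x (fun g => h (act g w) - h w).

Lemma stabilizer_acts_trivially_points (k : closedFieldType) (G : algGroup k)
    (X : gVariety G) (x : X) (W : gModule G) :
  stabilizer_acts_trivially x W ->
  forall g : G, act g x = x ->
  forall w : module_gvariety W, act g w = w.
Proof.
move=> triv g gx w; apply: acoord_inj => i.
have [n [a [h [_ _ E]]]] := triv w _ (regular_coord i).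
apply/eqP; rewrite -subr_eq0 [X in X == 0]E big1 // => j _.
by rewrite gx subrr mulr0.
Qed.

(* Main.v *)
Require Import Defs.
From HB Require Import structures.
From mathcomp Require Import all_boot all_order all_algebra.
From mathcomp Require Import mpoly.
From Stdlib Require Import Classical ClassicalEpsilon FunctionalExtensionality PropExtensionality.

Set Implicit Arguments.
Unset Strict Implicit.
Unset Printing Implicit Defensive.

Import GRing.Theory.
Local Open Scope ring_scope.

(** Write Y for the variety X_f.  The proof rests on a bi-invariant mean I on
    k[G], which linear reductivity provides ([haar_mean]), and on the form
    (b, h) |-> I (g |-> b (g x) h (g x)) on k[Y] attached to a point x of Y.

    The radical of this form is a proper G-stable ideal.  By the
    Nullstellensatz it has a zero y, and the radical at y is again the radical
    at x.  Hence there are nondegenerate points, the points where all functions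
    of their own radical vanish; a point with closed orbit is one of them
    ([closed_orbit_nondegenerate]).

    At a nondegenerate point x every a in k[G] has an orthogonal projection to
    the functions g |-> b (g x) with b in k[Y] ([orbit_projection]).  Indeed a
    is a matrix coefficient of a representation V, and nondegeneracy puts the
    values at x of the covariants Y -> V and Y -> V^* in perfect duality.  Since
    this projection is k[Y]-linear, it turns an identity
      u (g x) = phi (g) + sum_i a_i (g) (h_i (g x) - c_i)
    on G, where phi is orthogonal to k[Y], into one between functions on Y; so
    u vanishes at the zeros z of the radical with h_i z = c_i
    ([orbit_ideal_zero]).

    With u = 1, phi = 0 and c_i = h_i z this shows that a point z where the
    radical at x vanishes is on the orbit of x, so that this orbit is closed,
    whence (1) => (2).  With z = x and c_i = h_i x the sum is a general element
    of the stabilizer ideal of x: if the stabilizer acts trivially on W, every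
    vector of W is the value at x of a covariant ([covariant_through]).  The
    determinant of d covariants with independent values at x is a
    semi-invariant on X_f, and multiplying f by a numerator of it gives
    (2) => (3).  Cramer's rule gives (3) => (4).

    In (4) the isomorphism need neither be linear nor commute with the
    projections to X_f.  It maps (x, 0) to some (x', c), and x and x' have the
    same stabilizer H.  Comparing the H-fixed tangent vectors at these two
    points, dim T_x' ^H + d <= dim T_x ^H + dim W ^H.  If H acts nontrivially on
    W there are therefore more fixed tangent vectors at x than at x'
    ([tangent_step]); as H is also the stabilizer of x', this can be iterated,
    and the number of independent tangent vectors at x would not be bounded. *)

(** * The weak Nullstellensatz *)

(** A root of p X - 1 is a point where p does not vanish. *)
Lemma poly_nonroot (k : closedFieldType) (p : {poly k}) :
  p != 0 -> exists a, p.[a] != 0.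
Proof.
move=> p0; have : exists a, root (p * 'X - 1) a.
  apply/closed_rootP; rewrite size_polyDl ?size_mulX ?size_polyN ?size_poly1 //.
    by rewrite eqSS size_poly_eq0.
  by rewrite ltnS lt0n size_poly_eq0.
case=> a; rewrite /root !hornerE subr_eq0 => /eqP pa; exists a.
by apply: contra_eq_neq pa => ->; rewrite mul0r eq_sym oner_neq0.
Qed.

(** Induction on the number of variables: a nonzero coefficient of p with
    respect to the last variable can be made nonzero by choosing the values of
    the others, and a nonzero polynomial in one variable remains. *)
Lemma mpoly_nonroot (k : closedFieldType) n (p : {mpoly k[n]}) :
  p != 0 -> exists v, p.@[v] != 0.
Proof.
elim: n p => [|n IHn] p p0.
  exists (fun _ => 0); move: p0; apply: contra_neq.
  have -> : p = (p@_0)%:MP.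
    apply/mpolyP => m; rewrite mcoeffC.
    have -> : m = 0%MM by apply/mnmP; case.
    by rewrite eqxx mulr1.
  by rewrite mevalC => ->.
pose m := mlead p; have mS : m \in msupp p by rewrite mlead_supp.
pose wm (m : 'X_{1..n.+1}) := [multinom (m (widen_ord (leqnSn n) i)) | i < n].
pose q := (muni p)`_(m ord_max).
have q0 : q != 0.
  move: p0; rewrite -mleadc_eq0; apply: contra_neq => qe.
  rewrite -[RHS](mcoeff0 _ (wm m)) -qe /q muniE coef_sum raddf_sum /=.
  rewrite (bigD1_seq m) ?msupp_uniq //= [X in _ + X]big1 => [|m' nm].
    by rewrite !coefZ coefXn eqxx mulr1 mcoeffZ mcoeffX eqxx mulr1 addr0.
  rewrite !coefZ coefXn; case: eqP => [em|]; last first.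
    by rewrite !(mulr0, scaler0, mcoeff0).
  rewrite mulr1 mcoeffZ mcoeffX; case: eqP => [ew|]; last by rewrite mulr0.
  case/eqP: nm; apply/mnmP => i; case: (unliftP ord_max i) => [j ->|->] //.
  have /mnmP/(_ j) := ew; rewrite !mnmE.
  have -> // : widen_ord (leqnSn n) j = lift ord_max j.
  by apply: val_inj; rewrite /= /bump leqNgt ltn_ord.
have [v qv] := IHn _ q0.
have [|a ha] := @poly_nonroot k (map_poly (meval v) (muni p)).
  move: qv; apply: contra_neq => e.
  by have := congr1 (fun P : {poly _} => P`_(m ord_max)) e; rewrite coef_map coef0.
exists (fun i => oapp v a (unlift ord_max i)); move: ha; congr (_ != 0).
rewrite muniE [in RHS](mpolyE p) !raddf_sum /= horner_sum.
apply: eq_bigr => m' _; rewrite -!mul_polyC !rmorphM /= !map_polyC /= map_polyXn.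
rewrite !hornerE !mevalZ !mevalX big_ord_recr /= unlift_none mulrA.
congr (_ * _ * _); apply: eq_bigr => i _; rewrite mnmE.
have -> : widen_ord (leqnSn n) i = lift ord_max i.
  by apply: val_inj; rewrite /= /bump leqNgt ltn_ord.
by rewrite liftK.
Qed.

(** Morphisms out of a polynomial ring that are built in different ways are
    compared through this common form. *)
Lemma rmorph_mmap n (R S : comNzRingType) (phi : {rmorphism {mpoly R[n]} -> S}) p :
  phi p = mmap (phi \o @mpolyC n R) (fun i => phi 'X_i) p.
Proof.
rewrite {1}(mpolyE p) raddf_sum /=; apply: eq_bigr => m _.
rewrite -mul_mpolyC rmorphM /=; congr (_ * _).
rewrite mpolyXE_id rmorph_prod; apply: eq_bigr => i _; exact: rmorphXn.
Qed.

Lemma eq_mmap n (R S : comNzRingType) (f1 f2 : R -> S) (h1 h2 : 'I_n -> S) p :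
  f1 =1 f2 -> h1 =1 h2 -> mmap f1 h1 p = mmap f2 h2 p.
Proof.
move=> ef eh; apply: eq_bigr => m _; rewrite ef; congr (_ * _).
by apply: eq_bigr => i _; rewrite eh.
Qed.

(** The Sylvester matrix depends on the sizes of p and q, which f preserves
    as soon as it does not kill the leading coefficients. *)
Lemma map_resultant_coef (R S : nzRingType) (f : {rmorphism R -> S}) p q :
    f (lead_coef p) != 0 -> f (lead_coef q) != 0 ->
  f (resultant p q) = resultant (map_poly f p) (map_poly f q).
Proof.
move=> fp fq; rewrite /resultant -det_map_mx.
rewrite /Sylvester_mx !size_map_poly_id0 // map_col_mx.
congr (\det (col_mx _ _)); apply: map_lin1_mx => v.
  by rewrite map_poly_rV rmorphM /= map_rVpoly.
by rewrite map_poly_rV rmorphM /= map_rVpoly.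
Qed.

Section Tilt.
Variables (k : fieldType) (n : nat) (w : 'I_n.+1 -> k).

(** Substituting w_0 T for the first variable and X_i + w_i T for the others
    turns a polynomial of total degree e into one of degree at most e in T,
    whose coefficient of T^e is the value at w of the top form. *)
Definition tilt_var (i : 'I_n.+1) : {poly {mpoly k[n]}} :=
  oapp (fun j => ('X_j)%:P) 0 (unlift ord0 i) + (w i)%:MP *: 'X.

Local Notation tilt := (mmap (polyC \o @mpolyC n k) tilt_var).

(** The coefficient in degree d may vanish, which makes this notion
    multiplicative without any condition. *)
Definition top_coef (d : nat) (P : {poly {mpoly k[n]}}) (c : k) : Prop :=
  (size P <= d.+1)%N /\ P`_d = c%:MP.

Lemma top_coefM d e P Q a b :
  top_coef d P a -> top_coef e Q b -> top_coef (d + e) (P * Q) (a * b).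
Proof.
move=> [sP Pd] [sQ Qe]; split.
  apply: leq_trans (size_polyMleq _ _) _.
  by have := leq_add sP sQ; rewrite addSn addnS; case: (_ + size Q)%N.
rewrite coefM; have lt_d : (d < (d + e).+1)%N by rewrite ltnS leq_addr.
rewrite (bigD1 (Ordinal lt_d)) //= addKn Pd Qe -mpolyCM big1 ?addr0 // => i ni.
case: (ltngtP i d) => [lt_id|lt_di|eid].
- rewrite [Q`__]nth_default ?mulr0 //; apply: leq_trans sQ _.
  by rewrite ltn_subRL ltn_add2r.
- by rewrite [P`__]nth_default ?mul0r //; apply: leq_trans sP _.
- by case/eqP: ni; apply: val_inj.
Qed.

Lemma top_coef_tilt_var i : top_coef 1 (tilt_var i) (w i).
Proof.
rewrite /tilt_var; split.
  apply: leq_trans (size_polyD _ _) _; rewrite geq_max; apply/andP; split.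
    case: (unlift _ _) => [j|] /=; last by rewrite size_poly0.
    exact: leq_trans (size_polyC_leq1 _) _.
  by apply: leq_trans (size_scale_leq _ _) _; rewrite size_polyX.
rewrite coefD coefZ coefX mulr1; case: (unlift _ _) => [j|] /=.
  by rewrite coefC add0r.
by rewrite coef0 add0r.
Qed.

Lemma top_coef_tilt_mon (m : 'X_{1..n.+1}) :
  top_coef (mdeg m) (mmap1 tilt_var m) (\prod_i w i ^+ m i).
Proof.
rewrite mdegE /mmap1.
elim/big_rec3: _ => [|i d P c _ IH]; first by split; rewrite ?size_poly1 ?coefC.
apply: top_coefM IH; elim: (m i) => [|e IHe].
  by split; rewrite ?size_poly1 ?coefC.
by rewrite !exprS -add1n; apply: top_coefM IHe; exact: top_coef_tilt_var.
Qed.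

Definition top_form (p : {mpoly k[n.+1]}) : {mpoly k[n.+1]} :=
  \sum_(m <- msupp p | mdeg m == (msize p).-1) p@_m *: 'X_[m].

Lemma top_form_neq0 (p : {mpoly k[n.+1]}) : p != 0 -> top_form p != 0.
Proof.
move=> p0; have lp : mleadc p != 0 by rewrite mleadc_eq0.
apply: contra_neq lp => tp.
have := congr1 (mcoeff (mlead p)) tp; rewrite mcoeff0 /top_form raddf_sum /= => <-.
have mS : mlead p \in msupp p by rewrite mlead_supp.
rewrite (big_rem (mlead p)) //= -(mlead_deg p0) eqxx.
rewrite mcoeffZ mcoeffX eqxx mulr1 big1_seq ?addr0 // => m /andP[_].
rewrite mem_rem_uniq ?msupp_uniq // inE => /andP[/negbTE nm _].
by rewrite mcoeffZ mcoeffX nm mulr0.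
Qed.

Lemma top_coef_tilt (p : {mpoly k[n.+1]}) : p != 0 ->
  top_coef (msize p).-1 (tilt p) (top_form p).@[w].
Proof.
move=> p0; have sp : (msize p).-1.+1 = msize p.
  by rewrite prednK // lt0n msize_poly_eq0.
have tm (m : 'X_{1..n.+1}) := top_coef_tilt_mon m.
split; rewrite /mmap.
  rewrite sp; apply/leq_sizeP => j sj; rewrite coef_sum big1_seq // => m /andP[_ mp].
  rewrite coefCM [X in _ * X]nth_default ?mulr0 //.
  apply: leq_trans (proj1 (tm m)) (leq_trans _ sj); exact: msize_mdeg_lt.
rewrite coef_sum /top_form (rmorph_sum (meval w)) rmorph_sum [RHS]big_mkcond /=.
apply: eq_big_seq => m mp; rewrite coefCM; case: eqP => [<-|nm].
  by rewrite (proj2 (tm m)) mevalZ mevalX -mpolyCM.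
rewrite [X in _ * X]nth_default ?mulr0 //; apply: leq_trans (proj1 (tm m)) _.
have := msize_mdeg_lt mp; rewrite -sp ltnS leq_eqVlt => /orP[/eqP|//].
by move/nm.
Qed.

End Tilt.

Definition is_ideal (R : comNzRingType) (J : R -> Prop) : Prop :=
  [/\ J 0, forall a b, J a -> J b -> J (a + b) & forall a b, J b -> J (a * b)].

(** k[X] is principal: a nonzero element of least degree in K divides all
    others, and it has a root because it is not constant. *)
Lemma poly_ideal_root (k : closedFieldType) (K : {poly k} -> Prop) :
  is_ideal K -> ~ K 1 -> exists a, forall u, K u -> root u a.
Proof.
move=> [K0 KD KM] K1.
have [[u Ku u0]|nK] := classic (exists2 u, K u & u != 0); last first.
  exists 0 => u Ku; have [->|u0] := eqVneq u 0; first exact: root0.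
  by case: nK; exists u.
have [d sd] : exists d, size u = d by eexists.
elim/ltn_ind: d u Ku u0 sd => d IH u Ku u0 sd.
have [[v [Kv nv]]|dvd] := classic (exists v, K v /\ ~~ (u %| v)).
  have mv : v %% u != 0 by [].
  apply: (IH (size (v %% u)) _ (v %% u)) => //; first by rewrite -sd ltn_modp.
  have -> : v %% u = v + - (v %/ u) * u by rewrite {2}(divp_eq v u) mulNr addrC addKr.
  by apply: KD => //; apply: KM.
have su : size u != 1%N.
  apply/eqP => su; have [c c0 uc] := size_poly1P _ (introT eqP su).
  apply: K1; have -> : 1 = c^-1%:P * u by rewrite uc -polyCM mulVf.
  exact: KM.
have [a ua] := closed_rootP u su.
exists a => v Kv; have [/dvdpP[q ->]|nv] := boolP (u %| v).
  by rewrite rootM ua orbT.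
by case: dvd; exists v.
Qed.

(** The elements s of a k-algebra R behave modulo J like the coordinates of a
    point.  They are arbitrary, so that a linear change of variables only
    changes s.  If they satisfy a relation p modulo J, tilting the variables in
    a direction w where the top form of p does not vanish gives elements t and
    y, with y integral over k[t] modulo J.  By induction t specializes to some
    b, and y has to specialize to a common root of the polynomials F (b, X)
    with F (t, y) in J.  These form an ideal of k[X].  It is proper: if
    F (b, X) = 1, the resultant of F and of the equation P of y is in J, hence
    vanishes at b, although F (b, X) and P (b, X) are coprime. *)
Lemma ideal_specialization (k : closedFieldType) (R : comNzRingType)
    (c : {rmorphism k -> R}) (J : R -> Prop) : is_ideal J -> ~ J 1 ->
  forall n (s : 'I_n -> R), exists v : 'I_n -> k,
    forall p : {mpoly k[n]}, J (mmap c s p) -> p.@[v] = 0.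
Proof.
move=> [J0 JD JM] J1; have Jc a : J (c a) -> a = 0.
  move=> Ja; apply/eqP/negPn/negP => a0; apply: J1.
  by rewrite -(rmorph1 c) -(mulVf a0) rmorphM; apply: JM.
elim=> [|n IHn] s.
  exists (fun _ => 0) => p; have -> : p = (p@_0)%:MP.
    apply/mpolyP => m; rewrite mcoeffC.
    have -> : m = 0%MM by apply/mnmP; case.
    by rewrite eqxx mulr1.
  by rewrite mmapC mevalC; apply: Jc.
have [[p p0 Jp]|np] := classic (exists2 p : {mpoly k[n.+1]}, p != 0 & J (mmap c s p)); last first.
  exists (fun _ => 0) => p Jp; have [->|p0] := eqVneq p 0; first by rewrite meval0.
  by case: np; exists p.
have [w] : exists w, (top_form p * 'X_ord0).@[w] != 0.
  apply: mpoly_nonroot; rewrite mulf_neq0 ?top_form_neq0 //.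
  by rewrite -msize_poly_eq0 msizeX.
rewrite mevalM mevalXU mulf_eq0 negb_or => /andP[tw w0].
pose y := c (w ord0)^-1 * s ord0.
pose t i := s (lift ord0 i) - c (w (lift ord0 i)) * y.
pose T : {mpoly k[n.+1]} -> {poly {mpoly k[n]}} :=
  mmap (polyC \o @mpolyC n k) (tilt_var w).
pose E (P : {poly {mpoly k[n]}}) : R := (map_poly (mmap c t) P).[y].
have ED P Q : E (P + Q) = E P + E Q by rewrite /E rmorphD hornerD.
have EM P Q : E (P * Q) = E P * E Q by rewrite /E rmorphM hornerM.
have EC q : E q%:P = mmap c t q by rewrite /E map_polyC hornerC.
have ET q : E (T q) = mmap c s q.
  have -> : E (T q) = (horner_eval y \o map_poly (mmap c t) \o
     mmap (polyC \o @mpolyC n k) (tilt_var w)) q by [].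
  rewrite rmorph_mmap; apply: eq_mmap => [a|i].
    by rewrite /= mmapC /= map_polyC /= mmapC /horner_eval hornerC.
  rewrite /= mmapX mmap1U /tilt_var rmorphD /horner_eval /= hornerD.
  rewrite -mul_polyC rmorphM /= map_polyC map_polyX /= mmapC hornerM hornerC hornerX.
  case: (unliftP ord0 i) => [j ->|->] /=.
    by rewrite map_polyC /= hornerC mmapX mmap1U subrK.
  by rewrite rmorph0 horner0 add0r /y mulrA -rmorphM divff // rmorph1 mul1r.
have [b bP] := IHn t.
pose B : {poly {mpoly k[n]}} -> {poly k} := map_poly (meval b).
have B_T q a : (B (T q)).[a] = q.@[fun i => oapp b 0 (unlift ord0 i) + w i * a].
  have -> : (B (T q)).[a] = (horner_eval a \o map_poly (meval b) \o
     mmap (polyC \o @mpolyC n k) (tilt_var w)) q by [].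
  rewrite rmorph_mmap; apply: eq_mmap => [e|i].
    by rewrite /= mmapC /= map_polyC /= mevalC /horner_eval hornerC.
  rewrite /= mmapX mmap1U /tilt_var rmorphD /horner_eval /= hornerD.
  rewrite -mul_polyC rmorphM /= map_polyC map_polyX /= mevalC hornerM hornerC hornerX.
  congr (_ + _); case: (unlift ord0 i) => [j|] /=.
    by rewrite map_polyC /= hornerC mevalXU.
  by rewrite rmorph0 horner0.
pose K u := exists2 F, J (E F) & u = B F.
have KI : is_ideal K.
  split.
  - by exists 0; rewrite /E ?rmorph0 ?horner0 // /B rmorph0.
  - move=> _ _ [F JF ->] [F' JF' ->]; exists (F + F'); first by rewrite ED; apply: JD.
    by rewrite /B rmorphD.
  - move=> a _ [F JF ->]; exists (map_poly (@mpolyC n k) a * F).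
      by rewrite EM; apply: JM.
    rewrite /B rmorphM /=; congr (_ * _).
    by apply/polyP => i; rewrite !coef_map /= mevalC.
have [|a aP] := poly_ideal_root KI; last first.
  exists (fun i => oapp b 0 (unlift ord0 i) + w i * a) => q Jq.
  by rewrite -B_T; apply/rootP/aP; exists (T q); rewrite ?ET.
have [sP cP] := top_coef_tilt w p0; rewrite -/(T p) in sP cP.
set d := (msize p).-1 in sP cP; set P := T p in sP cP.
have JP : J (E P) by rewrite ET.
have cP0 : (top_form p).@[w]%:MP_[n] != 0 by rewrite mpolyC_eq0.
have {}sP : size P = d.+1.
  by apply/eqP; rewrite eqn_leq sP ltnNge; apply: contra_neqN cP0 => /leq_sizeP/(_ d (leqnn d)) <-.
have lP : lead_coef P = (top_form p).@[w]%:MP_[n] by rewrite lead_coefE sP cP.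
have [d0|d0] := posnP d.
  have eP : P = (top_form p).@[w]%:MP_[n]%:P.
    have s1 : (size P <= 1)%N by rewrite sP d0.
    by rewrite (size1_polyC s1) -cP d0.
  by move: JP; rewrite eP EC mmapC => /Jc/eqP; rewrite (negbTE tw).
case=> F JF BF.
(* This is congruent to F modulo P, and its leading coefficient, that of P,
   does not vanish at b. *)
pose f := F + P * 'X^(size F).
have P0 : P != 0 by rewrite -size_poly_eq0 sP.
have sFP : (size F < size (P * 'X^(size F))%R)%N.
  by rewrite size_mulXn // sP addnS ltnS leq_addr.
have lf : lead_coef f = lead_coef P.
  rewrite /f lead_coefDr // lead_coefM lead_coefXn mulr1 //.
have Jf : J (E f) by rewrite /f ED EM mulrC; apply: JD => //; rewrite mulrC mulrC; apply: JM.
have sf : (1 < size f)%N.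
  by rewrite /f addrC size_polyDl // size_mulXn // sP addnS ltnS ltn_addl.
have [|[u v] /= _ res] := @resultant_in_ideal _ f P sf; first by rewrite sP ltnS.
have rb : (resultant f P).@[b] = 0.
  apply: bP; rewrite -EC res ED !EM; apply: JD; exact: JM.
have tb : (lead_coef P).@[b] != 0 by rewrite lP mevalC.
move: rb; rewrite (map_resultant_coef (f := meval b)) ?lf //.
have -> : map_poly (meval b) f = 1 + B P * 'X^(size F).
  by rewrite /f rmorphD rmorphM /= map_polyXn -/(B F) -BF.
have : coprimep (1 + B P * 'X^(size F)) (B P).
  by rewrite coprimep_sym addrC mulrC coprimep_addl_mul coprimep1.
by rewrite /coprimep => /eqP gP /eqP; rewrite resultant_eq0 gP.
Qed.

Theorem mpoly_nullstellensatz (k : closedFieldType) n (J : {mpoly k[n]} -> Prop) :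
  is_ideal J -> ~ J 1 -> exists v : 'I_n -> k, forall p, J p -> p.@[v] = 0.
Proof.
move=> JI J1; have [v vP] := ideal_specialization (@mpolyC n k) JI J1 (fun i => 'X_i).
exists v => p Jp; apply: vP; move: Jp; congr J.
by rewrite [LHS](rmorph_mmap idfun).
Qed.

(** * Regular functions on affine varieties *)

Section RegularAlgebra.
Variables (k : closedFieldType) (X : affVariety k).
Implicit Types f g : X -> k.

Lemma regularD f g : regular f -> regular g -> regular (fun x => f x + g x).
Proof. by move=> [p pE] [q qE]; exists (p + q) => x; rewrite mevalD pE qE. Qed.

Lemma regularZ c f : regular f -> regular (fun x => c * f x).
Proof. by apply: regularM; exact: regular_cst. Qed.

Lemma regularN f : regular f -> regular (fun x => - f x).
Proof. by move=> [p pE]; exists (- p) => x; rewrite mevalN pE. Qed.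

Lemma regularB f g : regular f -> regular g -> regular (fun x => f x - g x).
Proof. by move=> rf /regularN; exact: regularD. Qed.

Lemma regular_sum (I : Type) (r : seq I) (P : pred I) (F : I -> X -> k) :
  (forall i, regular (F i)) -> regular (fun x => \sum_(i <- r | P i) F i x).
Proof.
move=> rF; elim: r => [|i r IH].
  by apply: eq_regular (regular_cst X 0) => x; rewrite big_nil.
apply: (@eq_regular _ _ (fun x => (if P i then F i x else 0) + \sum_(j <- r | P j) F j x)).
  by move=> x; rewrite big_cons; case: (P i) => //; rewrite add0r.
by case: (P i); apply: regularD => //; exact: regular_cst.
Qed.

Lemma regular_prod (I : Type) (r : seq I) (F : I -> X -> k) :
  (forall i, regular (F i)) -> regular (fun x => \prod_(i <- r) F i x).
Proof.
move=> rF; elim: r => [|i r IH].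
  by apply: eq_regular (regular_cst X 1) => x; rewrite big_nil.
apply: eq_regular (regularM (rF i) IH) => x; by rewrite big_cons.
Qed.

Lemma regularX n f : regular f -> regular (fun x => f x ^+ n).
Proof.
move=> rf; elim: n => [|n IH]; first by apply: eq_regular (regular_cst X 1).
by apply: eq_regular (regularM rf IH) => x; rewrite exprS.
Qed.

Lemma regular_det n (M : X -> 'M[k]_n) :
  (forall i j, regular (fun x => M x i j)) -> regular (fun x => \det (M x)).
Proof.
move=> rM; apply: regular_sum => s; apply: regularZ; apply: regular_prod => i.
exact: rM.
Qed.

Lemma regular_mulmx m n p (A : X -> 'M[k]_(m, n)) (B : X -> 'M[k]_(n, p)) :
  (forall i j, regular (fun x => A x i j)) ->
  (forall i j, regular (fun x => B x i j)) ->
  forall i j, regular (fun x => (A x *m B x) i j).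
Proof.
move=> rA rB i j; apply: (@eq_regular _ _ (fun x => \sum_l A x i l * B x l j)).
  by move=> x; rewrite mxE.
by apply: regular_sum => l; apply: regularM.
Qed.

Definition function_ideal (J : (X -> k) -> Prop) : Prop :=
  [/\ J (fun _ => 0), forall a b, J a -> J b -> J (fun x => a x + b x)
    & forall a b, regular a -> J b -> J (fun x => a x * b x)].

(** The ideal of polynomials inducing a function of J contains the equations of
    X, so that its zeros are points of X. *)
Lemma nullstellensatz (J : (X -> k) -> Prop) : function_ideal J ->
  ~ J (fun _ => 1) -> exists x, forall h, regular h -> J h -> h x = 0.
Proof.
move=> [J0 JD JM] J1.
pose J' (p : {mpoly k[adim (aff_structure X)]}) := J (fun x => p.@[point_coord x]).
have J'E p (f : X -> k) : (forall x, f x = p.@[point_coord x]) -> J f -> J' p.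
  by move=> fE; rewrite /J'; congr J; apply: functional_extensionality.
have [||v vP] := @mpoly_nullstellensatz k _ J'.
- split.
  + by apply: J'E J0 => x; rewrite meval0.
  + by move=> a b Ja Jb; apply: J'E (JD _ _ Ja Jb) => x; rewrite mevalD.
  + move=> a b Jb; apply: J'E (JM (fun x => a.@[point_coord x]) _ _ Jb).
      by move=> x; rewrite mevalM.
    by exists a.
- move=> J'1; apply: J1; move: J'1; congr J; apply: functional_extensionality => x.
  by rewrite meval1.
have [|x xE] := @acoord_closed _ _ (aff_structure X) v.
  by move=> p p0; apply: vP; apply: J'E J0 => x; rewrite p0.
exists x => h [p pE] Jh; rewrite pE (meval_eq _ xE); apply: vP; exact: J'E Jh.
Qed.

(** The multiples of f form an ideal without zeros. *)
Lemma regular_inv f : regular f -> (forall x, f x != 0) -> regular (fun x => (f x)^-1).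
Proof.
move=> rf f0; pose J (h : X -> k) := exists2 u, regular u & forall x, h x = u x * f x.
have JI : function_ideal J.
  split.
  - by exists (fun _ => 0) => [|x]; [exact: regular_cst|rewrite mul0r].
  - move=> a b [u ru ua] [v rv vb]; exists (fun x => u x + v x); first exact: regularD.
    by move=> x; rewrite ua vb mulrDl.
  - move=> a b ra [v rv vb]; exists (fun x => a x * v x); first exact: regularM.
    by move=> x; rewrite vb mulrA.
have [[u ru uf]|nJ1] := classic (J (fun _ => 1)).
  by apply: eq_regular ru => x; rewrite -[RHS]mul1r (uf x) mulfK.
have [x xP] := nullstellensatz JI nJ1.
have Jf : J f by exists (fun _ => 1) => [|y]; [exact: regular_cst|rewrite mul1r].
by have /eqP := xP f rf Jf; rewrite (negbTE (f0 x)).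
Qed.

End RegularAlgebra.

(** This proves that all regular functions have a property which is stable under
    sums and products, by taking for v the coordinates. *)
Lemma meval_closed (k : fieldType) (T : Type) (P : (T -> k) -> Prop) n
    (v : 'I_n -> T -> k) (p : {mpoly k[n]}) :
  (forall c, P (fun _ => c)) ->
  (forall f g, P f -> P g -> P (fun x => f x + g x)) ->
  (forall f g, P f -> P g -> P (fun x => f x * g x)) ->
  (forall i, P (v i)) -> P (fun x => p.@[fun i => v i x]).
Proof.
move=> Pc PD PM Pv.
have PE f g : f =1 g -> P g -> P f by move=> /(@functional_extensionality _ _ _ _) ->.
apply: (@PE _ (fun x => \sum_(m <- msupp p) p@_m * \prod_i v i x ^+ m i)).
  by move=> x; rewrite mevalE.
elim: (msupp p) => [|m r IH].
  by apply: PE (Pc 0) => x; rewrite big_nil.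
apply: (PE _ _ _ (PD _ _ _ IH)); first by move=> x; rewrite big_cons.
apply: (PM) => //; elim: (index_enum _) => [|i s IHs].
  by apply: PE (Pc 1) => x; rewrite big_nil.
apply: (PE _ _ _ (PM _ _ _ IHs)); first by move=> x; rewrite big_cons.
elim: (m i) => [|e IHe]; first by apply: PE (Pc 1) => x; rewrite expr0.
by apply: (PE _ _ _ (PM _ _ (Pv i) IHe)) => x; rewrite exprS.
Qed.

Section ProductDecomposition.
Variables (k : closedFieldType) (X Y : affVariety k).

Lemma morphism_pairl (y : Y) : @morphism k X (prodVariety X Y) (fun x => (x, y)).
Proof.
by apply: (@pair_morphism k X Y X) => // h _; exact: regular_cst.
Qed.

Lemma morphism_pairr (x : X) : @morphism k Y (prodVariety X Y) (fun y => (x, y)).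
Proof.
by apply: (@pair_morphism k X Y Y) => // h _; exact: regular_cst.
Qed.

Lemma prod_point_coordl (z : prodVariety X Y) j :
  point_coord z (lshift (adim (aff_structure Y)) j) = point_coord z.1 j.
Proof.
have -> : point_coord z (lshift _ j) = prod_coord z (lshift _ j) by [].
by rewrite /prod_coord (unsplitK (inl j)).
Qed.

Lemma prod_point_coordr (z : prodVariety X Y) j :
  point_coord z (rshift (adim (aff_structure X)) j) = point_coord z.2 j.
Proof.
have -> : point_coord z (rshift _ j) = prod_coord z (rshift _ j) by [].
by rewrite /prod_coord (unsplitK (inr j)).
Qed.

Lemma regular_prodP (h : prodVariety X Y -> k) : regular h ->
  exists (I : finType) (a : I -> X -> k) (b : I -> Y -> k),
    [/\ forall i, regular (a i), forall i, regular (b i)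
      & forall x y, h (x, y) = \sum_i a i x * b i y].
Proof.
move=> [p pE].
have -> : h = fun z => p.@[point_coord z] by apply: functional_extensionality.
pose P (h : prodVariety X Y -> k) :=
  exists (I : finType) (a : I -> X -> k) (b : I -> Y -> k),
    [/\ forall i, regular (a i), forall i, regular (b i)
      & forall x y, h (x, y) = \sum_i a i x * b i y].
apply: (@meval_closed k (prodVariety X Y) P _ (fun i z => point_coord z i)).
- move=> c; exists unit, (fun _ _ => c), (fun _ _ => 1); split=> [i|i|x y].
  + exact: regular_cst.
  + exact: regular_cst.
  + by rewrite (big_pred1 tt) ?mulr1 //; case.
- move=> f g [I [a [b [ra rb E]]]] [I' [a' [b' [ra' rb' E']]]].
  exists (I + I')%type, (fun i => match i with inl i => a i | inr i => a' i end),
    (fun i => match i with inl i => b i | inr i => b' i end).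
  split; [by case|by case|move=> x y].
  by rewrite big_sumType /= E E'.
- move=> f g [I [a [b [ra rb E]]]] [I' [a' [b' [ra' rb' E']]]].
  exists (I * I')%type, (fun i x => a i.1 x * a' i.2 x), (fun i x => b i.1 x * b' i.2 x).
  split=> [i|i|x y]; [exact: regularM|exact: regularM|].
  rewrite E E' big_distrlr /= pair_big /=; apply: eq_bigr => i _.
  by rewrite mulrACA.
- move=> i; rewrite -(splitK i); case: (split i) => j /=.
    exists unit, (fun _ x => point_coord x j), (fun _ _ => 1); split=> [_|_|x y].
    + exact: regular_coord.
    + exact: regular_cst.
    + rewrite (big_pred1 tt) ?mulr1 //.
      exact: (prod_point_coordl (x, y)).
  exists unit, (fun _ _ => 1), (fun _ x => point_coord x j); split=> [_|_|x y].
  + exact: regular_cst.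
  + exact: regular_coord.
  + rewrite (big_pred1 tt) ?mul1r //.
    exact: (prod_point_coordr (x, y)).
Qed.

End ProductDecomposition.

(** * Subspaces and matrix coefficients *)

Lemma ex_minimal (P : nat -> Prop) :
  (exists n, P n) -> exists n, P n /\ forall m, (m < n)%N -> ~ P m.
Proof.
case=> n; elim/ltn_ind: n => n IH Pn.
have [[m lt_mn Pm]|nP] := classic (exists2 m, (m < n)%N & P m); first exact: IH Pm.
by exists n; split=> // m lt_mn Pm; apply: nP; exists m.
Qed.

(** A subspace of maximal dimension among those on which P holds. *)
Lemma subspace_of_pred (k : fieldType) (V : vectType k) (P : V -> Prop) :
  P 0 -> (forall u v, P u -> P v -> P (u + v)) -> (forall a u, P u -> P (a *: u)) ->
  exists U : {vspace V}, forall v, v \in U <-> P v.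
Proof.
move=> P0 PD PZ.
have [n [[U [PU dU]] nmin]] : exists n,
    (exists U : {vspace V}, (forall v, v \in U -> P v) /\ (\dim {:V} - \dim U = n)%N)
    /\ forall m, (m < n)%N -> ~ (exists U : {vspace V}, (forall v, v \in U -> P v)
                                 /\ (\dim {:V} - \dim U = m)%N).
  apply: ex_minimal; exists (\dim {:V} - \dim (0%VS : {vspace V}))%N, 0%VS.
  by split=> // v; rewrite memv0 => /eqP ->.
exists U => v; split; first exact: PU.
move=> Pv; apply/negPn/negP => nv.
have sU : (U <= U + <[v]>)%VS by exact: addvSl.
have lt_dim : (\dim U < \dim (U + <[v]>))%N.
  rewrite ltn_neqAle dimvS // andbT; apply: contra nv => /eqP e.
  have /eqP -> : U == (U + <[v]>)%VS by rewrite eqEdim sU e leqnn.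
  by apply: (subvP (addvSr _ _)); exact: memv_line.
apply: (nmin (\dim {:V} - \dim (U + <[v]>))%N); last first.
  exists (U + <[v]>)%VS; split=> // w /memv_addP[u uU [_ /vlineP[a ->] ->]].
  by apply: PD; [exact: PU|exact: PZ].
by rewrite -dU ltn_sub2l // (leq_trans lt_dim) // dimvS // subvf.
Qed.

(** As long as the rank is less than N, some column c is killed by the vectors
    already chosen, and a point t with u t *m c != 0 increases the rank. *)
Lemma spanning_points (k : fieldType) (T : Type) N (u : T -> 'rV[k]_N) :
  (forall c : 'cV_N, (forall t, u t *m c = 0) -> c = 0) ->
  exists M (t : 'I_M -> T), row_full (\matrix_i u (t i)).
Proof.
move=> ind; suff H r : (r <= N)%N -> exists M (t : 'I_M -> T), (r <= \rank (\matrix_i u (t i)))%N.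
  have [M [t rt]] := H _ (leqnn N); exists M, t.
  by rewrite /row_full eqn_leq rank_leq_col.
elim: r => [|r IH] rN.
  by exists 0%N, (fun i : 'I_0 => match notF (valP i) with end).
have [M [t]] := IH (ltnW rN); set A := \matrix_i _ => rA.
have [|lt_r] := leqP r.+1 (\rank A); first by exists M, t.
have eA : \rank A = r by apply/eqP; rewrite eqn_leq rA andbT -ltnS.
have [t0 nt0] : exists t0, u t0 *m cokermx A != 0.
  have [//|nex] := classic (exists t0, u t0 *m cokermx A != 0).
  have cA0 : cokermx A = 0.
    apply/row_matrixP => i; apply/rowP => j.
    suff c0 : col j (cokermx A) = 0.
      by have := congr1 (fun B : 'cV_N => B i ord0) c0; rewrite !mxE.
    apply: ind => t0; rewrite colE mulmxA.
    have [->|n0] := eqVneq (u t0 *m cokermx A) 0; first by rewrite mul0mx.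
    by case: nex; exists t0.
  have := mxrank_coker A; rewrite cA0 mxrank0 eA => /eqP.
  by rewrite eq_sym subn_eq0 leqNgt rN.
exists M.+1, (fun i => oapp t t0 (unlift ord0 i)).
set A' := \matrix_i _; rewrite -eA; apply: rank_ltmx; rewrite ltmxE; apply/andP; split.
  apply/row_subP => i; have -> : row i A = row (lift ord0 i) A'.
    by rewrite !rowK liftK.
  exact: row_sub.
apply/negP => sA; case/negP: nt0.
have : (u t0 <= A')%MS.
  have <- : row ord0 A' = u t0 by rewrite rowK unlift_none.
  exact: row_sub.
by move/submx_trans/(_ sA); rewrite submxE.
Qed.

Section GroupFunctions.
Variables (k : closedFieldType) (G : algGroup k).
Local Notation GV := (group_variety G).
Local Notation regG := (@regular k GV).

Lemma regG_mull (phi : G -> k) (s : G) : regG phi -> regG (fun g => phi (s * g)%g).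
Proof.
by move=> rphi; apply: (morphism_pairr (Y := GV) (s : GV) (mulg_morphism rphi)).
Qed.

Lemma regG_mulr (phi : G -> k) (s : G) : regG phi -> regG (fun g => phi (g * s)%g).
Proof.
by move=> rphi; apply: (morphism_pairl (X := GV) (s : GV) (mulg_morphism rphi)).
Qed.

Lemma regG_inv (phi : G -> k) : regG phi -> regG (fun g => phi g^-1%g).
Proof. exact: invg_morphism. Qed.

Lemma regG_mulP (phi : G -> k) : regG phi ->
  exists (I : finType) (a b : I -> G -> k),
    [/\ forall i, regG (a i), forall i, regG (b i)
      & forall s g, phi (s * g)%g = \sum_i a i s * b i g].
Proof.
move=> rphi; have [I [a [b [ra rb E]]]] := regular_prodP (mulg_morphism rphi).
by exists I, a, b.
Qed.

Definition matrix_rep N (rho : G -> 'M[k]_N) : Prop :=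
  [/\ forall i j, regG (fun g => rho g i j), rho 1%g = 1%:M
    & forall g h, rho (g * h)%g = rho g *m rho h].

(** Take a factorization phi (s g) = a (s) b (g) of least inner dimension N.
    The entries of b and the columns of a are then linearly independent, so
    that finitely many values of a and b invert them.  Values of a give
    b (s g) = rho (s) b (g) for a matrix rho (s), and values of b show that rho
    is regular. *)
Lemma matrix_coefficients m (phi : 'I_m -> G -> k) : (forall j, regG (phi j)) ->
  exists N (rho : G -> 'M[k]_N) (C : 'M_(m, N)) (v : 'cV_N),
    [/\ matrix_rep rho,
        forall c : 'rV_N, (forall g, c *m rho g *m v = 0) -> c = 0
      & forall j g, phi j g = (C *m rho g *m v) j ord0].
Proof.
move=> rphi.
pose factors N (a : G -> 'M[k]_(m, N)) (b : G -> 'cV[k]_N) :=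
  (forall i, regG (fun g => b g i ord0)) /\
  forall s g, \col_j phi j (s * g)%g = a s *m b g.
have [N [[a [b [rb ab]]] minN]] : exists N, (exists a b, @factors N a b) /\
    forall N', (N' < N)%N -> ~ exists a b, @factors N' a b.
  apply: ex_minimal.
  have [I IE] := fin_all_exists (fun j => regG_mulP (rphi j)).
  have {IE}[a IE] := fin_all_exists IE; have {IE}[b IE] := fin_all_exists IE.
  pose K : finType := {j : 'I_m & I j}.
  exists #|K|, (fun s => \matrix_(j, i) (let x := enum_val i in
             if tag x == j then a (tag x) (tagged x) s else 0)),
    (fun g => \col_i b (tag (enum_val i)) (tagged (enum_val i)) g).
  split=> [i|s g].
    have [_ rb _] := IE (tag (enum_val i)).
    by apply: eq_regular (rb (tagged (enum_val i))) => g; rewrite mxE.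
  apply/colP => j; rewrite !mxE.
  under eq_bigr => i _ do rewrite !mxE.
  rewrite -(big_enum_val (fun x : K =>
     (if tag x == j then a (tag x) (tagged x) s else 0) * b (tag x) (tagged x) g)).
  have [_ _ ->] := IE j.
  transitivity (\sum_i \sum_(x : I i) (if i == j then a i x s else 0) * b i x g); last first.
    rewrite (sig_big_dep xpredT (fun _ => xpredT)
              (fun i x => (if i == j then a i x s else 0) * b i x g)).
    by apply: eq_bigl => x; rewrite inE.
  rewrite (bigD1 j) //= eqxx [X in _ + X]big1 ?addr0 // => i /negbTE ->.
  by rewrite big1 // => x _; rewrite mul0r.
have indb (c : 'rV_N) : (forall g, c *m b g = 0) -> c = 0.
  move=> cb; apply/eqP/negPn/negP => c0; pose B := row_base (kermx c^T).
  apply: (minN (\rank (kermx c^T))).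
    rewrite mxrank_ker mxrank_tr; case: N c c0 {B a b rb ab minN cb} => [|N] c c0.
      by case/eqP: c0; apply/rowP; case.
    by rewrite rank_rV c0 subSS subn0.
  exists (fun s => a s *m B^T), (fun g => (pinvmx B)^T *m b g); split=> [i|s g].
    apply: regular_mulmx => // *; first exact: regular_cst.
    by rewrite ord1.
  rewrite ab -mulmxA; congr (_ *m _); apply: trmx_inj.
  rewrite !trmx_mul !trmxK mulmxKpV // eq_row_base; apply/sub_kermxP.
  by rewrite -trmx_mul cb trmx0.
have inda (c : 'cV_N) : (forall s, a s *m c = 0) -> c = 0.
  move=> ac; apply/eqP/negPn/negP => c0; pose B := row_base (kermx c).
  apply: (minN (\rank (kermx c))).
    rewrite mxrank_ker -mxrank_tr; case: N c c0 {B a b rb ab minN ac indb} => [|N] c c0.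
      by case/eqP: c0; apply/colP; case.
    have cT0 : c^T != 0 by apply: contra_neq c0 => e; apply: trmx_inj; rewrite e trmx0.
    by rewrite rank_rV cT0 subSS subn0.
  exists (fun s => a s *m pinvmx B), (fun g => B *m b g); split=> [i|s g].
    apply: regular_mulmx => // *; first exact: regular_cst.
    by rewrite ord1.
  rewrite mulmxA mulmxKpV -?ab // eq_row_base; apply/sub_kermxP; exact: ac.
have [|M [t full_t]] := @spanning_points k G N (fun g => (b g)^T).
  move=> c bc; apply: trmx_inj; rewrite trmx0; apply: indb => g.
  by apply: trmx_inj; rewrite trmx_mul trmxK bc trmx0.
have [|M' [t' full_t']] := @spanning_points k (G * 'I_m) N (fun x => row x.2 (a x.1)).
  move=> c ac; apply: inda => s; apply/row_matrixP => i.
  by rewrite row_mul (ac (s, i)) row0.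
set Bt := \matrix_i _ in full_t; set At := \matrix_i _ in full_t'.
pose R := (pinvmx Bt)^T; pose L := pinvmx At.
have BtR : Bt^T *m R = 1%:M by rewrite -trmx_mul mulVpmx ?trmx1.
have LAt : L *m At = 1%:M by exact: mulVpmx.
(* L expresses b through finitely many translates of the functions phi. *)
pose rho g := L *m \matrix_i row (t' i).2 (a ((t' i).1 * g)%g).
have rhoE g h : b (g * h)%g = rho g *m b h.
  rewrite -[b (g * h)%g]mul1mx -LAt /rho -[LHS]mulmxA -[RHS]mulmxA; congr (L *m _).
  apply/row_matrixP => i; rewrite !row_mul !rowK -!row_mul -!ab.
  by apply/rowP => j; rewrite !mxE mulgA.
have rho_inj (A B : 'M[k]_N) : (forall g, A *m b g = B *m b g) -> A = B.
  move=> AB; apply/row_matrixP => i; apply/eqP; rewrite -subr_eq0; apply/eqP.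
  by apply: indb => g; rewrite mulmxBl -!row_mul AB subrr.
exists N, rho, (a 1%g), (b 1%g); split=> [|c cb|j g].
- split=> [i j||g h].
  + have -> : (fun g => rho g i j) = fun g => (\matrix_(l, i) b (g * t i)%g l ord0 *m R) i j.
      apply: functional_extensionality => g; congr (fun_of_matrix _ i j).
      rewrite -[LHS]mulmx1 -BtR mulmxA; congr (_ *m _).
      apply/matrixP => l e; rewrite [RHS]mxE rhoE !mxE; apply: eq_bigr => r _.
      by rewrite !mxE.
    apply: regular_mulmx => [l e|l e]; last exact: regular_cst.
    by apply: eq_regular (regG_mulr (t e) (rb l)) => g; rewrite mxE.
  + by apply: rho_inj => g; rewrite -rhoE mul1g mul1mx.
  + by apply: rho_inj => x; rewrite -mulmxA -!rhoE mulgA.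
- by apply: indb => g; rewrite -[g]mulg1 rhoE mulmxA.
- by rewrite -mulmxA -rhoE mulg1 -ab mxE mul1g.
Qed.
End GroupFunctions.

(** * The invariant mean of a linearly reductive group *)

Lemma regular_linear (k : closedFieldType) (V : vectType k) (f : {linear V -> k^o}) :
  regular (fun v : vectVariety V => f v : k).
Proof.
apply: (@eq_regular _ _ (fun v : vectVariety V =>
   \sum_i point_coord v i * (f (vbasis {:V})`_i : k))).
  move=> v; rewrite [in RHS](coord_vbasis (memvf (v : V))) linear_sum.
  by apply: eq_bigr => i _; rewrite linearZ.
by apply: regular_sum => i; apply: regularM; [exact: regular_coord|exact: regular_cst].
Qed.

Section RowVectors.
Variables (k : closedFieldType) (N : nat).
Let V : vectType k := 'rV[k]_N.

Lemma regular_rV_entry i j : regular (fun v : vectVariety V => (v : 'rV_N) i j).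
Proof.
have lf : linear (fun v : V => v i j : k^o) by move=> a u v; rewrite !mxE.
pose f : {linear V -> k^o} :=
  HB.pack (fun v : V => v i j : k^o) (GRing.isLinear.Build _ _ _ _ _ lf).
exact: (regular_linear f).
Qed.

Lemma rV_morphism (X : affVariety k) (F : X -> 'rV[k]_N) :
  (forall i j, regular (fun x => F x i j)) -> @morphism k X (vectVariety V) F.
Proof.
move=> rF; apply: (@coord_morphism k X (vectVariety V)) => i.
apply: (@eq_regular _ _ (fun x =>
  \sum_j F x ord0 j * coord (vbasis {:V}) i ('e_j : 'rV_N))).
  move=> x; transitivity (coord (vbasis {:V}) i (F x)); last by [].
  rewrite [in RHS](row_sum_delta (F x)) linear_sum.
  by apply: eq_bigr => j _; rewrite linearZ.
by apply: regular_sum => j; apply: regularM => //; exact: regular_cst.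
Qed.

End RowVectors.

Section RowModule.
Variables (k : closedFieldType) (G : algGroup k) (N : nat) (rho : G -> 'M[k]_N).
Hypothesis rho_rep : matrix_rep rho.
Let V : vectType k := 'rV[k]_N.

(** Left translation of functions by s is a right action on the rows of their
    coefficients; the inverse makes a left action of it. *)
Definition row_act (g : G) (v : V) : V := v *m rho g^-1%g.

Fact row_act1 v : row_act 1%g v = v.
Proof. by have [_ r1 _] := rho_rep; rewrite /row_act invg1 r1 mulmx1. Qed.

Fact row_actM g h v : row_act (g * h)%g v = row_act g (row_act h v).
Proof. by have [_ _ rM] := rho_rep; rewrite /row_act invgM rM mulmxA. Qed.

Fact row_act_morphism :
  @morphism k (prodVariety (group_variety G) (vectVariety V)) (vectVariety V)
    (fun gv => row_act gv.1 gv.2).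
Proof.
apply: rV_morphism.
apply: (@regular_mulmx k (prodVariety (group_variety G) (vectVariety V)) 1 N N
  (fun gv => gv.2) (fun gv => rho gv.1^-1%g)) => a b.
  exact: (@snd_morphism k (group_variety G) (vectVariety V) _ (@regular_rV_entry k N a b)).
have [rr _ _] := rho_rep.
exact: (@fst_morphism k (group_variety G) (vectVariety V) _ (regG_inv (rr a b))).
Qed.

Definition row_action : gAction G (vectVariety V) :=
  @GAction k G (vectVariety V) row_act row_act1 row_actM row_act_morphism.

Fact row_linear (g : G) : linear (gact row_action g : V -> V).
Proof. by move=> a u v; rewrite /= /row_act mulmxDl scalemxAl. Qed.

Definition row_module : gModule G := GModule row_linear.

Lemma row_complement (U : {vspace 'rV[k]_N}) : linearly_reductive G ->
  (forall g c, c \in U -> c *m rho g \in U) ->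
  exists U' : {vspace 'rV[k]_N},
    [/\ forall g c, c \in U' -> c *m rho g \in U', (U + U' = fullv)%VS
      & (U :&: U' = 0)%VS].
Proof.
move=> redG stU; have [|U' [stU' UU' U0]] := redG row_module U.
  by move=> g c cU; apply: stU.
exists U'; split=> // g c cU'; have := stU' g^-1%g c cU'.
by rewrite /= /row_act invgK.
Qed.

End RowModule.

Section Haar.
Variables (k : closedFieldType) (G : algGroup k).
Hypothesis redG : linearly_reductive G.
Local Notation regG := (@regular k (group_variety G)).

(** The span of the differences between a function and its translates; it is to
    be the complement of the constants that defines the mean. *)
Inductive translation_null : (G -> k) -> Prop :=
| Tnull0 : translation_null (fun _ => 0)
| TnullD f g : translation_null f -> translation_null g ->
    translation_null (fun x => f x + g x)
| Tnull_diff f s : regG f -> translation_null (fun x => f (s * x)%g - f x).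

Lemma translation_nullZ c f : translation_null f -> translation_null (fun x => c * f x).
Proof.
elim=> [|u v _ IHu _ IHv|u s ru].
- have -> : (fun _ : G => c * 0) = fun _ => 0.
    by apply: functional_extensionality => x; rewrite mulr0.
  exact: Tnull0.
- have -> : (fun x => c * (u x + v x)) = fun x => c * u x + c * v x.
    by apply: functional_extensionality => x; rewrite mulrDr.
  exact: TnullD.
- have -> : (fun x => c * (u (s * x)%g - u x)) = fun x => c * u (s * x)%g - c * u x.
    by apply: functional_extensionality => x; rewrite mulrBr.
  by apply: (@Tnull_diff (fun x => c * u x)); apply: regularZ.
Qed.

Lemma translation_nullP f : translation_null f ->
  exists m (psi : 'I_m -> G -> k) (s : 'I_m -> G), (forall i, regG (psi i)) /\
    forall x, f x = \sum_i (psi i (s i * x)%g - psi i x).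
Proof.
elim=> [|u v _ [m [psi [s [rp E]]]] _ [m' [psi' [s' [rp' E']]]]|u s ru].
- exists 0%N, (fun _ _ => 0), (fun _ => 1%g); split=> [[]//|x]; by rewrite big_ord0.
- exists (m + m')%N, (fun i => match split i with inl j => psi j | inr j => psi' j end),
    (fun i => match split i with inl j => s j | inr j => s' j end).
  split=> [i|x]; first by case: (split i).
  rewrite E E' big_split_ord; congr (_ + _); apply: eq_bigr => i _.
    by rewrite (unsplitK (inl i)).
  by rewrite (unsplitK (inr i)).
- by exists 1%N, (fun _ => u), (fun _ => s); split=> [//|x]; rewrite big_ord1.
Qed.

(** In a stable finite dimensional space containing 1 and the functions psi i,
    the line of constants has a stable complement.  It contains all differences
    of translates, because those of constants are zero. *)
Lemma one_not_translation_null : ~ translation_null (fun _ => 1).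
Proof.
move=> /translation_nullP[m [psi [s [rp E]]]].
pose phi (j : 'I_m.+1) := oapp psi (fun _ => 1) (unlift ord0 j).
have [|N [rho [C [v [rep ind CE]]]]] := @matrix_coefficients k G _ phi.
  by move=> j; rewrite /phi; case: (unlift _ _) => //=; exact: regular_cst.
have [_ _ rM] := rep.
pose c0 := row ord0 C.
have c0E g : (c0 *m rho g *m v) ord0 ord0 = 1.
  by rewrite /c0 -!row_mul mxE -CE /phi unlift_none.
have c0fix g : c0 *m rho g = c0.
  apply/eqP; rewrite -subr_eq0; apply/eqP; apply: ind => h.
  rewrite mulmxBl mulmxBl -[c0 *m rho g *m _]mulmxA -rM.
  apply/rowP => i; rewrite ord1 !mxE.
  by have := c0E h; have := c0E (g * h)%g; rewrite !mxE => -> ->; rewrite subrr.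
have c0n0 : c0 != 0.
  by apply: contra_eq_neq (c0E 1%g) => ->; rewrite !mul0mx mxE eq_sym oner_neq0.
have [|U' [stU' full cap]] := @row_complement k G N rho rep <[c0]>%VS redG.
  by move=> g _ /vlineP[a ->]; rewrite -scalemxAl c0fix memvZ ?memv_line.
have key : c0 \in U'.
  have -> : c0 = \sum_i (row (lift ord0 i) C *m rho (s i) - row (lift ord0 i) C).
    apply/eqP; rewrite -subr_eq0; apply/eqP; apply: ind => g.
    apply/rowP => i; rewrite ord1 mulmxBl mulmxBl [LHS]mxE [X in _ + X]mxE [RHS]mxE.
    rewrite c0E (E g) !mulmx_suml summxE; apply/eqP; rewrite subr_eq0; apply/eqP.
    apply: eq_bigr => j _; rewrite !mulmxBl -[_ *m rho (s j) *m _]mulmxA -rM.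
    rewrite -!row_mul !mxE.
    have := CE (lift ord0 j) (s j * g)%g; have := CE (lift ord0 j) g.
    by rewrite /phi liftK /= => -> ->; rewrite !mxE.
  apply: memv_suml => i _.
  have /memv_addP[_ /vlineP[a ->] [u uU' ->]] : row (lift ord0 i) C \in (<[c0]> + U')%VS.
    by rewrite full memvf.
  by rewrite mulmxDl -scalemxAl c0fix opprD addrACA subrr add0r memvB // stU'.
have : c0 \in (<[c0]> :&: U')%VS by rewrite memv_cap memv_line.
by rewrite cap memv0 (negbTE c0n0).
Qed.

(** In a stable finite dimensional space containing phi, take a stable
    complement to the null functions.  The differences of translates of its
    elements are in both spaces, so its elements are constant functions. *)
Lemma translation_null_mean phi : regG phi ->
  exists c, translation_null (fun x => phi x - c).
Proof.
move=> rphi.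
have [N [rho [C [v [rep ind CE]]]]] := @matrix_coefficients k G 1 (fun _ => phi) (fun _ => rphi).
have [rr _ rM] := rep.
pose fn (c : 'rV_N) x := (c *m rho x *m v) ord0 ord0.
have fnD c c' x : fn (c + c') x = fn c x + fn c' x by rewrite /fn !mulmxDl mxE.
have fnZ a c x : fn (a *: c) x = a * fn c x by rewrite /fn -!scalemxAl mxE.
have fnR c s x : fn (c *m rho s) x = fn c (s * x)%g.
  by rewrite /fn -[c *m _ *m _]mulmxA -rM.
have rfn c : regG (fn c).
  apply: regular_mulmx => [a b|a b]; last exact: regular_cst.
  by apply: regular_mulmx => // a' b'; exact: regular_cst.
have ex f f' : f =1 f' -> translation_null f -> translation_null f'.
  by move=> /functional_extensionality ->.
have [|||U UP] := @subspace_of_pred k 'rV[k]_N (fun c => translation_null (fn c)).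
- by apply: ex Tnull0 => x; rewrite /fn !mul0mx mxE.
- by move=> c c' Tc Tc'; apply: ex (TnullD Tc Tc') => x; rewrite fnD.
- by move=> a c Tc; apply: ex (translation_nullZ a Tc) => x; rewrite fnZ.
have diffU c s : c *m rho s - c \in U.
  apply/UP; apply: ex (Tnull_diff s (rfn c)) => x.
  by rewrite fnD -scaleN1r fnZ mulN1r fnR.
have [|U' [stU' full cap]] := @row_complement k G N rho rep U redG.
  by move=> g c cU; rewrite -[_ *m _](subrK c) memvD.
have /memv_addP[u uU [u' uU' Cu]] : row ord0 C \in (U + U')%VS by rewrite full memvf.
exists (fn u' 1%g); have /UP := uU; apply: ex => x.
have u'fix s : u' *m rho s = u'.
  apply/eqP; rewrite -subr_eq0 -memv0 -cap memv_cap diffU memvB //; exact: stU'.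
have -> : phi x = fn (row ord0 C) x by rewrite (CE ord0) /fn -!row_mul [RHS]mxE.
have <- : fn u' x = fn u' 1%g by rewrite -[in LHS](u'fix x^-1%g) fnR mulVg.
by rewrite Cu fnD addrK.
Qed.

End Haar.

Section Mean.
Variables (k : closedFieldType) (G : algGroup k).
Local Notation regG := (@regular k (group_variety G)).

Definition mean (I : (G -> k) -> k) : Prop :=
  [/\ forall f g, regG f -> regG g -> I (fun x => f x + g x) = I f + I g,
      forall c f, regG f -> I (fun x => c * f x) = c * I f
    & I (fun _ => 1) = 1].

Definition left_invariant (I : (G -> k) -> k) : Prop :=
  forall f s, regG f -> I (fun x => f (s * x)%g) = I f.

Definition right_invariant (I : (G -> k) -> k) : Prop :=
  forall f s, regG f -> I (fun x => f (x * s)%g) = I f.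

Lemma mean_sum I (K : Type) (r : seq K) (F : K -> G -> k) : mean I ->
  (forall i, regG (F i)) ->
  I (fun x => \sum_(i <- r) F i x) = \sum_(i <- r) I (F i).
Proof.
move=> [ID IZ I1] rF; elim: r => [|i r IH].
  rewrite big_nil -[RHS](mul0r (I (fun _ => 1))) -IZ ?I1; last exact: regular_cst.
  by congr I; apply: functional_extensionality => x; rewrite big_nil mul0r.
rewrite big_cons -IH -ID //; last exact: (@regular_sum k (group_variety G)).
by congr I; apply: functional_extensionality => x; rewrite big_cons.
Qed.

Lemma mean_cst I c : mean I -> I (fun _ => c) = c.
Proof.
move=> [_ IZ I1]; rewrite -[RHS]mulr1 -I1 -IZ; last exact: regular_cst.
by congr I; apply: functional_extensionality => x; rewrite mulr1.
Qed.

Lemma left_invariant_mean : linearly_reductive G ->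
  exists I, mean I /\ left_invariant I.
Proof.
move=> redG.
pose I (f : G -> k) := epsilon (inhabits 0) (fun c => translation_null (fun x => f x - c)).
have IP f : regG f -> translation_null (fun x => f x - I f).
  by move=> rf; exact: (epsilon_spec (inhabits 0) _ (translation_null_mean redG rf)).
have IE f c : regG f -> translation_null (fun x => f x - c) -> I f = c.
  move=> rf Tc; apply/eqP; rewrite -subr_eq0; apply/negPn/negP => n0.
  apply: (one_not_translation_null redG).
  have T := translation_nullZ (I f - c)^-1 (TnullD Tc (translation_nullZ (-1) (IP f rf))).
  move: T; congr translation_null; apply: functional_extensionality => x.
  by rewrite mulN1r opprB [X in _ * X]addrC addrA subrK mulVf.
exists I; split; [split|].
- move=> f g rf rg; apply: IE; first exact: (@regularD k (group_variety G)).
  have := TnullD (IP f rf) (IP g rg); congr translation_null.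
  by apply: functional_extensionality => x; rewrite opprD addrACA.
- move=> c f rf; apply: IE; first exact: (@regularZ k (group_variety G)).
  have := translation_nullZ c (IP f rf); congr translation_null.
  by apply: functional_extensionality => x; rewrite mulrBr.
- apply: IE; first exact: regular_cst.
  have := Tnull0 G; congr translation_null.
  by apply: functional_extensionality => x; rewrite subrr.
- move=> f s rf; apply: IE; first exact: regG_mull.
  have := TnullD (Tnull_diff s rf) (IP f rf); congr translation_null.
  by apply: functional_extensionality => x; rewrite addrA subrK.
Qed.

(** If J is the composite of the left invariant I with inversion, then J is right
    invariant, and applying I and J to the two variables of f (s g), in either
    order, gives I f = J f. *)
Theorem haar_mean : linearly_reductive G ->
  exists I, [/\ mean I, left_invariant I & right_invariant I].
Proof.
move=> redG; have [I [mI lI]] := left_invariant_mean redG; exists I; split=> //.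
pose J f := I (fun x => f x^-1%g).
have [ID IZ I1] := mI.
have mJ : mean J.
  split=> //.
  + by move=> f g rf rg; apply: ID; apply: regG_inv.
  + by move=> c f rf; apply: IZ; apply: regG_inv.
have rJ : right_invariant J.
  move=> f s rf; rewrite /J -[LHS](lI _ s); last exact: (regG_inv (regG_mulr s rf)).
  by congr I; apply: functional_extensionality => x; rewrite invgM mulgVK.
suff E f : regG f -> I f = J f.
  by move=> f s rf; rewrite !E //; [exact: rJ|exact: regG_mulr].
move=> rf; have [K [a [b [ra rb ab]]]] := regG_mulP rf.
have S1 s : \sum_i a i s * I (b i) = I f.
  rewrite -[RHS](lI _ s) //.
  rewrite -[RHS](_ : I (fun x => \sum_i a i s * b i x) = _); last first.
    by congr I; apply: functional_extensionality => x; rewrite ab.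
  rewrite mean_sum //; last by move=> i; apply: (@regularZ k (group_variety G)).
  by apply: eq_bigr => i _; rewrite IZ.
have S2 g : \sum_i J (a i) * b i g = J f.
  rewrite -[RHS](rJ _ g) //.
  rewrite -[RHS](_ : J (fun x => \sum_i b i g * a i x) = _); last first.
    congr J; apply: functional_extensionality => x; rewrite ab.
    by apply: eq_bigr => i _; rewrite mulrC.
  rewrite mean_sum //; last by move=> i; apply: (@regularZ k (group_variety G)).
  have [_ JZ _] := mJ; by apply: eq_bigr => i _; rewrite JZ // mulrC.
transitivity (\sum_i J (a i) * I (b i)).
  rewrite -(mean_cst (I f) mJ).
  rewrite -[LHS](_ : J (fun s => \sum_i I (b i) * a i s) = _); last first.
    congr J; apply: functional_extensionality => s; rewrite -(S1 s).
    by apply: eq_bigr => i _; rewrite mulrC.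
  rewrite mean_sum //; last by move=> i; apply: (@regularZ k (group_variety G)).
  have [_ JZ _] := mJ; by apply: eq_bigr => i _; rewrite JZ // mulrC.
rewrite -[RHS](mean_cst _ mI).
rewrite -[RHS](_ : I (fun g => \sum_i J (a i) * b i g) = _); last first.
  by congr I; apply: functional_extensionality => g; rewrite S2.
rewrite mean_sum //; last by move=> i; apply: (@regularZ k (group_variety G)).
by apply: eq_bigr => i _; rewrite IZ.
Qed.

End Mean.

(** * The form attached to an orbit *)

Section OrbitPairing.
Variables (k : closedFieldType) (G : algGroup k) (Y : gVariety G).
Local Notation GV := (group_variety G).
Local Notation regG := (@regular k GV).

Lemma regular_act (h : Y -> k) : regular h ->
  @regular k (prodVariety GV Y) (fun gy => h (act gy.1 gy.2)).
Proof. exact: gact_morphism. Qed.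

Lemma regular_orbit_map (h : Y -> k) (y : Y) : regular h -> regG (fun g => h (act g y)).
Proof. by move=> /regular_act rh; apply: (morphism_pairl (X := GV) y rh). Qed.

Lemma regular_translate (h : Y -> k) (g : G) : regular h -> regular (fun y => h (act g y)).
Proof. by move=> /regular_act rh; apply: (morphism_pairr (X := GV) (Y := Y) g rh). Qed.

Lemma actM (g h : G) (y : Y) : act (g * h)%g y = act g (act h y).
Proof. exact: gactM. Qed.

Lemma act1 (y : Y) : act 1%g y = y.
Proof. exact: gact1. Qed.

Variable I : (G -> k) -> k.
Hypotheses (mI : mean I) (lI : left_invariant I) (rI : right_invariant I).

Lemma eq_mean (f g : G -> k) : f =1 g -> I f = I g.
Proof. by move=> /functional_extensionality ->. Qed.

Lemma mean0 : I (fun _ => 0) = 0.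
Proof. exact: mean_cst. Qed.

Lemma regular_average (H : prodVariety GV Y -> k) : regular H ->
  regular (fun y : Y => I (fun g => H (g, y))).
Proof.
move=> /regular_prodP[K [a [b [ra rb E]]]]; have [_ IZ _] := mI.
apply: (@eq_regular _ _ (fun y => \sum_i I (a i) * b i y)).
  move=> y; rewrite [RHS](eq_mean (E ^~ y)).
  rewrite mean_sum // => [|i]; last by apply: (@regularM k GV) => //; exact: regular_cst.
  apply: eq_bigr => i _; rewrite mulrC -IZ //.
  by apply: eq_mean => g; rewrite mulrC.
by apply: regular_sum => i; apply: regularZ.
Qed.

(** The radical of the form (b, h) |-> I (g |-> b (g x) h (g x)). *)
Definition orbit_radical (x : Y) (b : Y -> k) : Prop :=
  regular b /\ forall h, regular h -> I (fun g => b (act g x) * h (act g x)) = 0.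

(** Since the radical is stable under translations, its elements then vanish on
    the whole orbit of x. *)
Definition nondegenerate (x : Y) : Prop := forall b, orbit_radical x b -> b x = 0.

Lemma orbit_radicalP x : function_ideal (orbit_radical x).
Proof.
have [ID IZ I1] := mI.
split.
- split; first exact: regular_cst.
  by move=> h _; rewrite -[RHS]mean0; apply: eq_mean => g; rewrite mul0r.
- move=> a b [ra Ra] [rb Rb]; split; first exact: regularD.
  move=> h rh; rewrite -[RHS]addr0 -[in X in _ = X + _](Ra h rh) -(Rb h rh) -ID.
  + by apply: eq_mean => g; rewrite mulrDl.
  + by apply: (@regularM k GV); exact: regular_orbit_map.
  + by apply: (@regularM k GV); exact: regular_orbit_map.
- move=> a b ra [rb Rb]; split; first exact: regularM.
  move=> h rh; rewrite -[RHS](Rb (fun y => a y * h y)); last exact: regularM.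
  by apply: eq_mean => g; rewrite mulrCA mulrA.
Qed.

Lemma orbit_radical_translate x b s : orbit_radical x b ->
  orbit_radical x (fun y => b (act s y)).
Proof.
move=> [rb Rb]; split; first exact: regular_translate.
move=> h rh; rewrite -[RHS](Rb (fun y => h (act s^-1%g y))); last exact: regular_translate.
rewrite -[RHS](lI s).
  by apply: eq_mean => g; rewrite -!actM mulKg.
apply: (@regularM k GV); first exact: regular_orbit_map.
by apply: (regular_orbit_map (h := fun y => h (act s^-1%g y))); exact: regular_translate.
Qed.

Lemma orbit_radical1 x : ~ orbit_radical x (fun _ => 1).
Proof.
move=> [_ /(_ (fun _ => 1) (regular_cst _ 1))]; rewrite mul1r mean_cst // => /eqP.
by rewrite oner_eq0.
Qed.

Lemma nondegenerate_orbit x b g : nondegenerate x -> orbit_radical x b -> b (act g x) = 0.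
Proof. by move=> nd /(orbit_radical_translate g)/nd. Qed.

(** The function y |-> I (g |-> h (g y)) is invariant, so its difference with
    its value at x is in the radical at x. *)
Lemma radical_zero_mean x z h : (forall b, orbit_radical x b -> b z = 0) ->
  regular h -> I (fun g => h (act g z)) = I (fun g => h (act g x)).
Proof.
move=> zP rh; have [ID IZ I1] := mI.
apply/eqP; rewrite -subr_eq0; apply/eqP.
pose c := I (fun g => h (act g x)).
have ravg : regular (fun y => I (fun g => h (act g y))).
  exact: (regular_average (regular_act rh)).
apply: (zP (fun y => I (fun g => h (act g y)) - c)); split.
  by apply: regularB => //; exact: regular_cst.
move=> f rf; rewrite -[RHS]mean0; apply: eq_mean => g.
suff -> : I (fun g' => h (act g' (act g x))) = c by rewrite subrr mul0r.
rewrite /c -[RHS](rI g); last exact: regular_orbit_map.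
by apply: eq_mean => g'; rewrite actM.
Qed.

Lemma radical_zero_radical x z b : (forall b, orbit_radical x b -> b z = 0) ->
  orbit_radical z b -> orbit_radical x b.
Proof.
move=> zP [rb Rb]; split=> // h rh.
rewrite -(radical_zero_mean (h := fun y => b y * h y) zP); last exact: regularM.
exact: Rb.
Qed.

Lemma nondegenerate_exists (y0 : Y) : exists x : Y, nondegenerate x.
Proof.
have [x xP] := nullstellensatz (orbit_radicalP y0) (@orbit_radical1 y0).
have {}xP b : orbit_radical y0 b -> b x = 0 by move=> Rb; exact: (xP _ (proj1 Rb) Rb).
exists x => b Rb; exact: (xP _ (radical_zero_radical xP Rb)).
Qed.

(** The functions vanishing on the orbit are in the radical.  So a zero of the
    radical lies on the orbit, and a translation moves it to x. *)
Lemma closed_orbit_nondegenerate x : zariski_closed (gorbit x) -> nondegenerate x.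
Proof.
move=> [S [rS SP]] b0 Rb0; apply: NNPP => nb.
have [z zP] := nullstellensatz (orbit_radicalP x) (@orbit_radical1 x).
have {}zP b : orbit_radical x b -> b z = 0 by move=> Rb; exact: (zP _ (proj1 Rb) Rb).
have [g zE] : gorbit x z.
  apply/SP => h Sh; apply: zP; split; first exact: rS.
  move=> f rf; rewrite -[RHS]mean0; apply: eq_mean => g.
  by have /SP/(_ h Sh) -> : gorbit x (act g x); [exists g|rewrite mul0r].
apply: nb; have := zP _ (orbit_radical_translate g^-1%g Rb0).
by rewrite zE -actM mulVg act1.
Qed.

Definition vec_covariant N (rho : G -> 'M[k]_N) (F : Y -> 'cV[k]_N) : Prop :=
  (forall i, regular (fun y => F y i ord0)) /\ forall g y, F (act g y) = rho g *m F y.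

Lemma vec_covariant_average N (rho : G -> 'M[k]_N) (v : 'cV_N) (h : Y -> k) :
  matrix_rep rho -> regular h ->
  vec_covariant rho (fun y => \col_i I (fun g => (rho g^-1%g *m v) i ord0 * h (act g y))).
Proof.
move=> [rr r1 rM] rh; have [ID IZ I1] := mI.
have rrv i : regG (fun g => (rho g^-1%g *m v) i ord0).
  apply: regular_mulmx => [a b|a b]; last exact: regular_cst.
  exact: (regG_inv (rr a b)).
split=> [i|s y].
  apply: (@eq_regular _ _ (fun y => I (fun g => (rho g^-1%g *m v) i ord0 * h (act g y)))).
    by move=> y; rewrite mxE.
  apply: (@regular_average (fun gy => (rho gy.1^-1%g *m v) i ord0 * h (act gy.1 gy.2))).
  apply: regularM; last exact: regular_act.
  exact: (@fst_morphism k GV Y _ (rrv i)).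
apply/colP => i; rewrite !mxE.
transitivity (I (fun g => \sum_j rho s i j * ((rho g^-1%g *m v) j ord0 * h (act g y)))).
  rewrite -[LHS](rI s^-1%g).
    apply: eq_mean => g; rewrite -actM mulgVK invgM invgK rM -mulmxA [in LHS]mxE.
    by rewrite mulr_suml; apply: eq_bigr => j _; rewrite mulrA.
  apply: (@regularM k GV) => //.
  by apply: (regular_orbit_map (h := h)).
rewrite mean_sum // => [|j]; last first.
  by apply: (@regularZ k GV); apply: (@regularM k GV) => //; exact: regular_orbit_map.
apply: eq_bigr => j _; rewrite IZ ?mxE //.
by apply: (@regularM k GV) => //; exact: regular_orbit_map.
Qed.

Definition dual_rep N (rho : G -> 'M[k]_N) (g : G) : 'M[k]_N := (rho g^-1%g)^T.

Lemma dual_repP N (rho : G -> 'M[k]_N) : matrix_rep rho -> matrix_rep (dual_rep rho).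
Proof.
move=> [rr r1 rM]; split=> [i j||g h].
- by apply: eq_regular (regG_inv (rr j i)) => g; rewrite mxE.
- by rewrite /dual_rep invg1 r1 trmx1.
- by rewrite /dual_rep invgM rM trmx_mul.
Qed.

(** For a function h and a basis vector e_j, the pairing of F' x with the value
    at x of the average of h *: e_j is the form at x applied to the j-th entry
    of F' and to h.  So this entry is in the radical. *)
Lemma dual_covariant_pairing N (rho : G -> 'M[k]_N) x (F' : Y -> 'cV_N) :
  matrix_rep rho -> nondegenerate x -> vec_covariant (dual_rep rho) F' ->
  (forall F, vec_covariant rho F -> (F' x)^T *m F x = 0) -> F' x = 0.
Proof.
move=> rep nd [rF' eF'] F'0; apply/colP => j; rewrite mxE.
apply: (nd (fun y => F' y j ord0)); split=> // h rh.
pose F y := \col_i I (fun g => (rho g^-1%g *m delta_mx j ord0 : 'cV_N) i ord0 * h (act g y)).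
have cF : vec_covariant rho F by apply: vec_covariant_average.
have [rr _ _] := rep; have [_ IZ _] := mI.
have rg i : regG (fun g => (rho g^-1%g *m delta_mx j ord0 : 'cV_N) i ord0 * h (act g x)).
  apply: (@regularM k GV); last exact: regular_orbit_map.
  apply: regular_mulmx => [a b|a b]; last exact: regular_cst.
  exact: (regG_inv (rr a b)).
have /(congr1 (fun A : 'M_1 => A ord0 ord0)) := F'0 F cF.
rewrite [RHS]mxE => e; rewrite -[RHS]e {e} mxE.
transitivity (I (fun g => \sum_i F' x i ord0 *
    ((rho g^-1%g *m delta_mx j ord0 : 'cV_N) i ord0 * h (act g x)))).
  apply: eq_mean => g; rewrite eF' /dual_rep mxE mulr_suml; apply: eq_bigr => i _.
  by rewrite -colE !mxE mulrA [X in X * _]mulrC.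
rewrite mean_sum // => [|i]; last by apply: (@regularZ k GV).
by apply: eq_bigr => i _; rewrite IZ // !mxE.
Qed.

(** By [dual_covariant_pairing], only 0 among the values at x of the dual
    covariants is orthogonal to all values at x of covariants.  The latter thus
    separate the former, and for any v there is F such that F x and v have the
    same pairings with the values of dual covariants. *)
Lemma covariant_decomposition N (rho : G -> 'M[k]_N) x (v : 'cV_N) :
  matrix_rep rho -> nondegenerate x ->
  exists2 F, vec_covariant rho F & forall F', vec_covariant (dual_rep rho) F' ->
    (F' x)^T *m (v - F x) = 0.
Proof.
move=> rep nd.
have space (sigma : G -> 'M[k]_N) : exists U : {vspace 'cV[k]_N},
    forall u, u \in U <-> exists2 F, vec_covariant sigma F & F x = u.
  apply: subspace_of_pred.
  - exists (fun _ => 0); last by [].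
    split=> [i|g y]; last by rewrite mulmx0.
    by apply: eq_regular (regular_cst _ 0) => y; rewrite mxE.
  - move=> _ _ [F [rF eF] <-] [F' [rF' eF'] <-]; exists (fun y => F y + F' y) => //.
    split=> [i|g y]; last by rewrite eF eF' mulmxDr.
    by apply: eq_regular (regularD (rF i) (rF' i)) => y; rewrite mxE.
  - move=> a _ [F [rF eF] <-]; exists (fun y => a *: F y) => //.
    split=> [i|g y]; last by rewrite eF scalemxAr.
    by apply: eq_regular (regularZ a (rF i)) => y; rewrite mxE.
have [U UP] := space rho; have [U' UP'] := space (dual_rep rho).
pose A := \matrix_(i, j) (vbasis U)`_j i ord0 : 'M[k]_(N, \dim U).
pose A' := \matrix_(j, i) (vbasis U')`_j i ord0 : 'M[k]_(\dim U', N).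
have AP c : exists2 F, vec_covariant rho F & F x = A *m c.
  apply/UP; have -> : A *m c = \sum_j c j ord0 *: (vbasis U)`_j.
    by apply/colP => i; rewrite mxE summxE; apply: eq_bigr => j _; rewrite !mxE mulrC.
  by apply: memv_suml => j _; apply: memvZ; apply: vbasis_mem; by rewrite mem_nth ?size_tuple.
have AP' c : exists2 F, vec_covariant (dual_rep rho) F & (F x)^T = c *m A'.
  have [F cF Fx] : exists2 F, vec_covariant (dual_rep rho) F & F x = (c *m A')^T.
    apply/UP'; have -> : (c *m A')^T = \sum_j c ord0 j *: (vbasis U')`_j.
      by apply/colP => i; rewrite !mxE summxE; apply: eq_bigr => j _; rewrite !mxE.
    by apply: memv_suml => j _; apply: memvZ; apply: vbasis_mem; by rewrite mem_nth ?size_tuple.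
  by exists F; rewrite // Fx trmxK.
pose M := A' *m A.
have freeM : row_free M.
  apply: inj_row_free => c cM; have [F cF Fx] := AP' c.
  have cA' : c *m A' = 0.
    rewrite -Fx (dual_covariant_pairing rep nd cF) ?trmx0 // => F2 cF2.
    have [d Fd] : exists d, F2 x = A *m d.
      have F2U : F2 x \in U by apply/UP; exists F2.
      exists (\col_j coord (vbasis U) j (F2 x)).
      rewrite [LHS](coord_vbasis F2U); apply/colP => i; rewrite mxE summxE.
      by apply: eq_bigr => j _; rewrite !mxE mulrC.
    by rewrite Fx Fd mulmxA -[c *m A' *m A]mulmxA cM mul0mx.
  apply/rowP => j; rewrite mxE.
  have /freeP := basis_free (vbasisP U'); apply; rewrite -[RHS](trmx0 _ 1 N) -cA'.
  by apply/colP => i; rewrite !mxE summxE; apply: eq_bigr => l _; rewrite !mxE.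
have [P MP] := row_freeP freeM.
have [F cF Fx] := AP (P *m (A' *m v)).
exists F => // F' cF'; have [c Fc] : exists c, (F' x)^T = c *m A'.
  have F'U : F' x \in U' by apply/UP'; exists F'.
  exists (\row_j coord (vbasis U') j (F' x)).
  apply: trmx_inj; rewrite trmxK [LHS](coord_vbasis F'U); apply/colP => i.
  by rewrite !mxE summxE; apply: eq_bigr => j _; rewrite !mxE.
rewrite Fx Fc mulmxBr !mulmxA -[c *m A' *m A]mulmxA -/M -[c *m M *m _]mulmxA MP.
by rewrite mulmx1 subrr.
Qed.

(** This mean is the pairing of w with the value at x of the dual covariant
    obtained by averaging h *: C^T. *)
Lemma pairing_average N (rho : G -> 'M[k]_N) x (C : 'rV_N) (w : 'cV_N) h :
  matrix_rep rho ->
  (forall F', vec_covariant (dual_rep rho) F' -> (F' x)^T *m w = 0) ->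
  regular h -> I (fun g => (C *m rho g *m w) ord0 ord0 * h (act g x)) = 0.
Proof.
move=> rep wP rh; have [rr _ _] := rep; have [_ IZ _] := mI.
have := wP _ (vec_covariant_average C^T (dual_repP rep) rh).
move/(congr1 (fun A : 'M_1 => A ord0 ord0)); rewrite [RHS]mxE => <-; rewrite mxE.
have rg i : regG (fun g => (dual_rep rho g^-1%g *m C^T) i ord0 * h (act g x)).
  apply: (@regularM k GV); last exact: regular_orbit_map.
  apply: regular_mulmx => [a b|a b]; last exact: regular_cst.
  have [rd _ _] := dual_repP rep; exact: (regG_inv (rd a b)).
transitivity (I (fun g => \sum_i w i ord0 *
    ((dual_rep rho g^-1%g *m C^T) i ord0 * h (act g x)))).
  apply: eq_mean => g; rewrite mxE mulr_suml; apply: eq_bigr => i _.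
  by rewrite /dual_rep invgK -trmx_mul [in RHS]mxE mulrA [X in X * _]mulrC.
rewrite mean_sum // => [|i]; last by apply: (@regularZ k GV).
by apply: eq_bigr => i _; rewrite IZ // [in RHS]mxE mulrC [in RHS]mxE.
Qed.

(** If a is the matrix coefficient C rho (g) v, decompose v as F x + w with w
    orthogonal to the dual covariants at x; then b is C F. *)
Lemma orbit_projection x (a : G -> k) : nondegenerate x -> regG a ->
  exists b : Y -> k, regular b /\ forall h, regular h ->
    I (fun g => (a g - b (act g x)) * h (act g x)) = 0.
Proof.
move=> nd ra.
have [N [rho [C [v [rep _ CE]]]]] := @matrix_coefficients k G 1 (fun _ => a) (fun _ => ra).
have [F [rF eF] Fv] := covariant_decomposition v rep nd.
exists (fun y => (C *m F y) ord0 ord0); split.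
  apply: regular_mulmx => [i j|i j]; first exact: regular_cst.
  by rewrite ord1.
move=> h rh; rewrite -[RHS](pairing_average C rep Fv rh); apply: eq_mean => g.
by rewrite (CE ord0) eF mulmxA mulmxBr [in RHS]mxE [X in _ = (_ + X) * _]mxE.
Qed.

(** Replacing each a_i by its projection b_i turns the identity on G into the
    fact that u - sum_i b_i (h_i - c_i) is in the radical at x; the value of
    this function at z is u z. *)
Lemma orbit_ideal_zero x z (K : finType) (u : Y -> k) (phi : G -> k)
    (a : K -> G -> k) (h : K -> Y -> k) (c : K -> k) :
  nondegenerate x -> (forall b, orbit_radical x b -> b z = 0) ->
  regular u -> regG phi -> (forall i, regG (a i)) -> (forall i, regular (h i)) ->
  (forall f, regular f -> I (fun g => phi g * f (act g x)) = 0) ->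
  (forall g, u (act g x) = phi g + \sum_i a i g * (h i (act g x) - c i)) ->
  (forall i, h i z = c i) -> u z = 0.
Proof.
move=> nd zP ru rphi ra rh phi0 uE hz; have [ID IZ _] := mI.
have [b bP] := fin_all_exists (fun i => orbit_projection nd (ra i)).
pose r y := u y - \sum_i b i y * (h i y - c i).
have rhc i : regular (fun y => h i y - c i) by apply: regularB => //; exact: regular_cst.
suff Rr : orbit_radical x r.
  have := zP r Rr; rewrite /r big1 ?subr0 // => i _; by rewrite hz subrr mulr0.
split.
  by apply: regularB => //; apply: regular_sum => i; apply: regularM => //; case: (bP i).
move=> f rf.
have rt i : regG (fun g => (a i g - b i (act g x)) * ((h i (act g x) - c i) * f (act g x))).
  apply: (@regularM k GV).
    by apply: (@regularB k GV) => //; apply: regular_orbit_map; case: (bP i).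
  by apply: (regular_orbit_map (h := fun y => (h i y - c i) * f y)); exact: regularM.
transitivity (I (fun g => phi g * f (act g x) +
    \sum_i (a i g - b i (act g x)) * ((h i (act g x) - c i) * f (act g x)))).
  apply: eq_mean => g; rewrite /r uE -addrA -sumrB mulrDl mulr_suml; congr (_ + _).
  by apply: eq_bigr => i _; rewrite -mulrBl mulrA.
rewrite ID; first last.
- exact: (@regular_sum k GV).
- by apply: (@regularM k GV) => //; exact: regular_orbit_map.
rewrite phi0 // add0r mean_sum // big1 // => i _.
by have [_ /(_ (fun y => (h i y - c i) * f y))] := bP i; apply; exact: regularM.
Qed.

(** The orbit of a nondegenerate point x is the set of zeros of its radical.
    For such a zero z, the equations h (g x) = h z in g have a solution by the
    Nullstellensatz, because [orbit_ideal_zero] excludes a relation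
    1 = sum_i a_i (g) (h_i (g x) - h_i z). *)
Lemma closed_orbit_exists (y0 : Y) : exists x : Y, zariski_closed (gorbit x).
Proof.
have [x nd] := nondegenerate_exists y0; exists x, (orbit_radical x); split=> [h []//|z].
split=> [[g ->] b Rb|zP]; first exact: nondegenerate_orbit.
pose J (phi : G -> k) := exists (K : finType) (a : K -> G -> k) (h : K -> Y -> k),
  [/\ forall i, regG (a i), forall i, regular (h i)
    & forall g, phi g = \sum_i a i g * (h i (act g x) - h i z)].
have JI : @function_ideal k GV J.
  split.
  - exists void, (fun _ _ => 0), (fun _ _ => 0); split=> [[]|[]|g].
    by rewrite big1 // => -[].
  - move=> f f' [K [a [h [ra rh E]]]] [K' [a' [h' [ra' rh' E']]]].
    exists (K + K')%type, (fun i => match i with inl i => a i | inr i => a' i end),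
      (fun i => match i with inl i => h i | inr i => h' i end).
    by split; [case|case|move=> g; rewrite big_sumType /= E E'].
  - move=> f f' rf [K [a [h [ra rh E]]]]; exists K, (fun i g => f g * a i g), h.
    split=> // [i|g]; first exact: (@regularM k GV).
    by rewrite E mulr_sumr; apply: eq_bigr => i _; rewrite mulrA.
have [[K [a [h [ra rh E]]]]|nJ1] := classic (J (fun _ => 1)).
  have : (1 : k) = 0.
    apply: (@orbit_ideal_zero x z K (fun _ => 1) (fun _ => 0) a h (h ^~ z)) => //.
    + exact: regular_cst.
    + exact: regular_cst.
    + by move=> f rf; rewrite -[RHS]mean0; apply: eq_mean => g; rewrite mul0r.
    + by move=> g; rewrite add0r.
  by move/eqP; rewrite oner_eq0.
have [g gP] := nullstellensatz JI nJ1.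
exists g; apply: acoord_inj => i; apply: esym; apply: subr0_eq.
apply: (gP (fun g => point_coord (act g x) i - point_coord z i)).
  apply: (@regularB k GV); last exact: regular_cst.
  by apply: (regular_orbit_map (h := fun y => point_coord y i)); exact: regular_coord.
exists unit, (fun _ _ => 1), (fun _ y => point_coord y i); split=> [_|_|g'].
- exact: regular_cst.
- exact: regular_coord.
- by rewrite (big_pred1 tt) ?mul1r //; case.
Qed.

(** Decompose v as F x + w with w orthogonal to the dual covariants at x.  The
    hypothesis gives an expression of F (g x) - v to which [orbit_ideal_zero]
    applies at z = x. *)
Lemma covariant_through x N (rho : G -> 'M[k]_N) (v : 'cV_N) :
  matrix_rep rho -> nondegenerate x ->
  (forall i, stabilizer_ideal x (fun g => (rho g *m v) i ord0 - v i ord0)) ->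
  exists2 F, vec_covariant rho F & F x = v.
Proof.
move=> rep nd stab; have [F cF wP] := covariant_decomposition v rep nd.
exists F => //; apply/colP => i; apply/eqP; rewrite -subr_eq0; apply/eqP.
have [n [a [h [ra rh E]]]] := stab i; have [rF eF] := cF.
have [rr _ _] := rep; set w := v - F x in wP.
have rw (u : 'cV_N) : regG (fun g => (rho g *m u) i ord0).
  by apply: regular_mulmx => [p q|p q] //; exact: regular_cst.
apply: (@orbit_ideal_zero x x _ (fun y => F y i ord0 - v i ord0)
  (fun g => - (rho g *m w) i ord0) a h (h ^~ x)) => //.
- by apply: regularB => //; exact: regular_cst.
- exact: (@regularN k GV).
- move=> f rf; have := pairing_average (delta_mx ord0 i) rep wP rf.
  move=> e; have [_ IZ _] := mI; rewrite -[RHS](mulr0 (-1)) -[in RHS]e -IZ.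
    by apply: eq_mean => g; rewrite mulN1r mulNr -mulmxA -rowE [in RHS]mxE.
  apply: (@regularM k GV); last exact: regular_orbit_map.
  by apply: eq_regular (rw w) => g; rewrite -mulmxA -rowE [RHS]mxE.
- move=> g; rewrite -E eF /w mulmxBr [X in _ = - X + _]mxE [X in _ = - (_ + X) + _]mxE.
  by rewrite opprB addrA subrK.
Qed.

End OrbitPairing.

(** * Modules in coordinates, and principal open subsets *)

Section ModuleMatrix.
Variables (k : closedFieldType) (G : algGroup k) (W : gModule G).
Local Notation GV := (group_variety G).
Local Notation d := (\dim {:W}).
Local Notation actW := (gact (gm_action W)).

Definition module_col (w : W) : 'cV[k]_d := \col_i coord (vbasis {:W}) i w.

Definition module_vec (c : 'cV[k]_d) : W := \sum_i c i ord0 *: (vbasis {:W})`_i.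

Definition module_rep (g : G) : 'M[k]_d :=
  \matrix_(i, j) coord (vbasis {:W}) i (actW g (vbasis {:W})`_j).

Lemma module_colK : cancel module_col module_vec.
Proof.
move=> w; rewrite [RHS](coord_vbasis (memvf w)) /module_vec.
by apply: eq_bigr => i _; rewrite mxE.
Qed.

Lemma module_vecK : cancel module_vec module_col.
Proof.
move=> c; apply/colP => i; rewrite mxE.
exact: coord_sum_free (basis_free (vbasisP _)).
Qed.

Lemma module_rep_col g w : module_col (actW g w) = module_rep g *m module_col w.
Proof.
have lg : linear (actW g) by exact: gm_linear.
pose L : {linear W -> W} := HB.pack (actW g) (GRing.isLinear.Build _ _ _ _ _ lg).
apply/colP => i; rewrite !mxE -[in LHS](module_colK w).
rewrite -[actW g _]/(L _) /module_vec !linear_sum; apply: eq_bigr => j _.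
by rewrite !linearZ /= !mxE mulrC.
Qed.

Lemma module_repP : matrix_rep module_rep.
Proof.
have inj_rep (A B : 'M[k]_d) : (forall w, A *m module_col w = B *m module_col w) -> A = B.
  move=> AB; apply/matrixP => i j; have := AB (module_vec (delta_mx j ord0)).
  by rewrite module_vecK -!colE => /colP/(_ i); rewrite !mxE.
split=> [i j||g h].
- apply: (@eq_regular k GV (fun g => vect_coord (actW g (vbasis {:W})`_j) i)).
    by move=> g; rewrite mxE.
  have /(morphism_pairl (X := GV) (Y := vectVariety W) (vbasis {:W})`_j) :=
    gact_morphism (gm_action W) (regular_coord (X := vectVariety W) i).
  exact.
- by apply: inj_rep => w; rewrite -module_rep_col gact1 mul1mx.
- by apply: inj_rep => w; rewrite -mulmxA -!module_rep_col gactM.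
Qed.

Lemma regular_module_col i j :
  regular (fun w : module_gvariety W => module_col w i j).
Proof.
by apply: eq_regular (regular_coord (X := vectVariety W) i) => w'; rewrite mxE.
Qed.

Lemma module_vec_morphism (X : affVariety k) (F : X -> 'cV[k]_d) :
  (forall i, regular (fun x => F x i ord0)) ->
  @morphism k X (module_gvariety W) (fun x => module_vec (F x)).
Proof.
move=> rF; apply: (@coord_morphism k X (vectVariety W)) => i.
apply: eq_regular (rF i) => x.
by have /colP/(_ i) := module_vecK (F x); rewrite mxE => <-.
Qed.

Lemma module_vec_act g c : module_vec (module_rep g *m c) = actW g (module_vec c).
Proof. by apply: (can_inj module_colK); rewrite module_vecK module_rep_col module_vecK. Qed.

End ModuleMatrix.

Section OpenSubsets.
Variables (k : closedFieldType) (G : algGroup k) (X : gVariety G).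
Local Notation GV := (group_variety G).

Lemma regular_open_incl (f : relInvariant X) (h : X -> k) : regular h ->
  regular (fun x : openGVariety f => h (open_incl x)).
Proof. exact: (sval_morphism (relinv_regular f)). Qed.

Lemma open_coord_lshift (f : X -> k) (rf : regular f) (z : openVariety rf) j :
  point_coord z (lshift 1 j) = point_coord (sval z) j.
Proof.
have -> : point_coord z (lshift 1 j) = open_coord z (lshift 1 j) by [].
by rewrite /open_coord (unsplitK (inl j)).
Qed.

Lemma open_coord_rshift (f : X -> k) (rf : regular f) (z : openVariety rf) (j : 'I_1) :
  point_coord z (rshift (adim (aff_structure X)) j) = (f (sval z))^-1.
Proof.
have -> : point_coord z (rshift _ j) = open_coord z (rshift _ j) by [].
by rewrite /open_coord (unsplitK (inr j)).
Qed.

Lemma clear_denominators (f : X -> k) (rf : regular f) (u : openVariety rf -> k) :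
  regular u -> exists m v, regular v /\
    forall z : openVariety rf, u z * f (sval z) ^+ m = v (sval z).
Proof.
move=> [p pE]; have -> : u = fun z => p.@[point_coord z].
  exact: functional_extensionality.
apply: (@meval_closed k (openVariety rf) (fun u => exists m v, regular v /\
    forall z : openVariety rf, u z * f (sval z) ^+ m = v (sval z)) _
    (fun i z => point_coord z i)).
- move=> c; exists 0%N, (fun _ => c); split; first exact: regular_cst.
  by move=> z; rewrite mulr1.
- move=> a b [m [v [rv E]]] [m' [v' [rv' E']]].
  exists (m + m')%N, (fun x => v x * f x ^+ m' + v' x * f x ^+ m); split.
    by apply: regularD; apply: regularM => //; apply: regularX.
  by move=> z; rewrite -E -E' mulrDl exprD !mulrA -[b z * _ * _]mulrAC.
- move=> a b [m [v [rv E]]] [m' [v' [rv' E']]].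
  exists (m + m')%N, (fun x => v x * v' x); split; first exact: regularM.
  by move=> z; rewrite -E -E' exprD mulrACA.
- move=> i; rewrite -(splitK i); case: (split i) => j /=.
    exists 0%N, (fun x => point_coord x j); split; first exact: regular_coord.
    by move=> z; rewrite mulr1 open_coord_lshift.
  exists 1%N, (fun _ => 1); split; first exact: regular_cst.
  by move=> z; rewrite open_coord_rshift expr1 mulVf //; exact: (svalP z).
Qed.

(** The function f' is f times a numerator of D.  The factor f makes it vanish
    outside X_f, where the numerator is not controlled. *)
Lemma semi_invariant_extends (f : relInvariant X) (D : openGVariety f -> k)
    (chi : G -> k) (z0 : openGVariety f) :
  regular D -> D z0 != 0 -> is_character chi ->
  (forall g z, D (act g^-1%g z) = chi g * D z) ->
  exists f' : relInvariant X, nonzero_fun f' /\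
    exists i : openGVariety f' -> openGVariety f,
      [/\ morphism i, equivariant i & forall y, D (i y) != 0].
Proof.
move=> rD D0 [rchi chi0 chiM] DE.
have [m [v [rv vE]]] := clear_denominators rD.
have [theta [[rth th0 thM] fE]] := relinv_character f.
have rf := relinv_regular f.
pose f1 x := f x * v x.
have rf1 : regular f1 by exact: regularM.
(* f1 is D f^(m + 1) on X_f. *)
pose th1 g := theta g ^+ m.+1 * chi g.
have f1E (z : openGVariety f) : f1 (open_incl z) = D z * f (open_incl z) ^+ m.+1.
  by rewrite /f1 -vE exprS mulrCA.
have ch1 : exists theta : G -> k, is_character theta /\
    forall g x, f1 (act g^-1%g x) = theta g * f1 x.
  exists th1; split.
    split.
    - by apply: (@regularM k GV) => //; apply: (@regularX k GV).
    - by move=> g; rewrite mulf_neq0 ?expf_neq0.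
    - by move=> g h; rewrite /th1 thM chiM exprMn mulrACA.
  move=> g x; have [fx0|fx] := eqVneq (f x) 0.
    by rewrite /f1 fE fx0 mulr0 !mul0r mulr0.
  pose z : openGVariety f := exist _ x fx.
  have -> : act g^-1%g x = open_incl (act g^-1%g z) by [].
  have -> : x = open_incl z by [].
  rewrite !f1E DE.
  have -> : open_incl (act g^-1%g z) = act g^-1%g (open_incl z) by [].
  by rewrite fE exprMn /th1 mulrACA mulrA mulrA [chi g * _]mulrC.
pose f' := RelInvariant rf1 ch1; exists f'; split.
  by exists (open_incl z0); rewrite /= f1E mulf_neq0 // expf_neq0 //; exact: (svalP z0).
have fi (y : openGVariety f') : f (sval y) != 0.
  by have := svalP y; rewrite /= /f1 mulf_eq0 negb_or => /andP[].
exists (fun y => exist _ (sval y) (fi y)); split.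
- apply: to_open_morphism => /=; first exact: (sval_morphism (relinv_regular f')).
  apply: (@eq_regular k (openGVariety f') (fun y => v (sval y) * (f' (sval y))^-1)).
    move=> y; have := svalP y; rewrite /= /f1 mulf_eq0 negb_or => /andP[fy vy].
    by rewrite invfM mulrCA divff // mulr1.
  apply: (@regularM k (openGVariety f')).
    exact: (sval_morphism (relinv_regular f') rv).
  exact: (regular_invf (relinv_regular f')).
- by move=> g y; apply: val_inj.
- move=> y; have := svalP y; rewrite /= => f1y; apply: contra_neq f1y => Dy.
  by have := f1E (exist _ (sval y) (fi y)); rewrite Dy mul0r.
Qed.

Lemma stabilizer_ideal_open (f : relInvariant X) (x : openGVariety f) phi :
  stabilizer_ideal (open_incl x) phi -> stabilizer_ideal x phi.
Proof.
move=> [n [a [h [ra rh E]]]]; exists n, a, (fun i y => h i (open_incl y)); split=> // i.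
exact: regular_open_incl.
Qed.

End OpenSubsets.

(** * From trivial stabilizers to covariants and trivializations *)

Section Implications.
Variables (k : closedFieldType) (G : algGroup k) (X : gVariety G) (W : gModule G).
Local Notation GV := (group_variety G).
Local Notation d := (\dim {:W}).

Lemma exists_closed_orbit (Y : gVariety G) (y0 : Y) : linearly_reductive G ->
  exists x : Y, zariski_closed (gorbit x).
Proof. by move=> /haar_mean[I [mI lI rI]]; exact: (closed_orbit_exists mI lI rI y0). Qed.

Lemma closed_orbit_covariants (Y : gVariety G) (x : Y) :
  linearly_reductive G -> zariski_closed (gorbit x) ->
  (forall w i, stabilizer_ideal x
     (fun g => module_col (act g w : module_gvariety W) i ord0 - module_col w i ord0)) ->
  forall c : 'cV_d, exists2 F, vec_covariant (Y := Y) (@module_rep k G W) F & F x = c.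
Proof.
move=> /haar_mean[I [mI lI rI]] clx stab c.
have nd := closed_orbit_nondegenerate mI lI clx.
apply: (covariant_through mI rI (module_repP W) nd) => i.
have := stab (module_vec c) i; congr (stabilizer_ideal _ _).
apply: functional_extensionality => g.
by rewrite /act /= module_rep_col module_vecK.
Qed.

Lemma det_covariants_act (Y : gVariety G) (F : 'I_d -> Y -> 'cV[k]_d) g y :
  (forall j, vec_covariant (@module_rep k G W) (F j)) ->
  \det (\matrix_(i, j) F j (act g y) i ord0) =
  \det (module_rep W g) * \det (\matrix_(i, j) F j y i ord0).
Proof.
move=> cF; rewrite -det_mulmx; congr (\det _); apply/matrixP => i j.
rewrite mxE (proj2 (cF j)) !mxE; by apply: eq_bigr => l _; rewrite !mxE.
Qed.

Lemma det_character : is_character (fun g => \det (module_rep W g^-1%g)).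
Proof.
have [rr r1 rM] := module_repP W; split.
- apply: (@regular_det k GV d (fun g => module_rep W g^-1%g)) => i j.
  exact: (regG_inv (rr i j)).
- move=> g; have : \det (module_rep W g^-1%g) * \det (module_rep W g) = 1.
    by rewrite -det_mulmx -rM mulVg r1 det1.
  by move=> e; apply: contra_eq_neq e => ->; rewrite mul0r eq_sym oner_neq0.
- by move=> g h; rewrite invgM rM det_mulmx mulrC.
Qed.

Lemma free_module_vec (c : 'I_d -> 'cV[k]_d) :
  \det (\matrix_(i, j) c j i ord0) != 0 ->
  free [tuple module_vec (W := W) (c i) | i < d].
Proof.
set M := \matrix_(i, j) _ => M0; apply/freeP => a a0 i.
have Ma : M *m (\col_j a j) = 0.
  apply: (can_inj (@module_vecK k G W)).
  have -> : module_vec (W := W) 0 = 0.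
    by rewrite /module_vec big1 // => j _; rewrite mxE scale0r.
  rewrite -[RHS]a0 /module_vec.
  under [RHS]eq_bigr => j _ do rewrite (nth_map j) ?size_enum_ord // scaler_sumr.
  rewrite exchange_big /=; apply: eq_bigr => l _; rewrite mxE scaler_suml.
  apply: eq_bigr => j _; rewrite !mxE scalerA nth_ord_enum mulrC //.
have uM : M \in unitmx by rewrite unitmxE unitfE.
have : invmx M *m (M *m (\col_j a j)) = 0 by rewrite Ma mulmx0.
by rewrite mulKmx // => /colP/(_ i); rewrite !mxE.
Qed.

Lemma free_det_neq0 (w : 'I_d -> W) : free [tuple w i | i < d] ->
  \det (\matrix_(i, j) module_col (w j) i ord0) != 0.
Proof.
set M := \matrix_(i, j) _ => fw; rewrite -unitfE -unitmxE -unitmx_tr -row_free_unit.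
apply: inj_row_free => c cM; apply/rowP => i; rewrite mxE.
have /freeP := fw; apply; rewrite (eq_bigr (fun j => c ord0 j *: w j)); last first.
  by move=> j _; rewrite (nth_map j) ?size_enum_ord // nth_ord_enum.
apply: (can_inj (@module_colK k G W)).
apply/colP => l; rewrite !mxE linear_sum linear0 /=.
have /rowP/(_ l) := cM; rewrite !mxE => e; rewrite -[RHS]e.
apply: eq_bigr => j _.
by rewrite linearZ /= !mxE.
Qed.

Lemma regular_covariant_col (Y : gVariety G) (F : Y -> W) i j : covariant F ->
  regular (fun y => module_col (F y) i j).
Proof. by move=> [mF _]; exact: (mF _ (@regular_module_col k G W i j)). Qed.

(** The matrix M of the covariants is invertible, with regular inverse by
    Cramer's rule and [regular_inv]. *)
Lemma covariants_trivialize (Y : gVariety G) (F : 'I_d -> Y -> W) :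
  (forall i, covariant (F i)) -> (forall y, free [tuple F i y | i < d]) ->
  gisomorphic (prodGVariety Y (module_gvariety W))
    (prodGVariety Y (module_gvariety (trivModule G d))).
Proof.
move=> cF fF; pose M y : 'M[k]_d := \matrix_(i, j) module_col (F j y) i ord0.
have dM y : \det (M y) != 0 by exact: free_det_neq0.
have uM y : M y \in unitmx by rewrite unitmxE unitfE.
have rM i j : regular (fun y => M y i j).
  apply: eq_regular (regular_covariant_col i ord0 (cF j)) => y; by rewrite [RHS]mxE.
have rIM i j : regular (fun y => invmx (M y) i j).
  apply: (@eq_regular _ _ (fun y => (\det (M y))^-1 * cofactor (M y) j i)).
    by move=> y; rewrite /invmx uM !mxE.
  apply: regularM; first by apply: regular_inv => //; exact: regular_det.
  apply: regularZ; apply: regular_det => a b.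
  by apply: eq_regular (rM (lift j a) (lift i b)) => y; rewrite !mxE.
have ME g y : M (act g y) = module_rep W g *m M y.
  apply/matrixP => i j; have [_ eF] := cF j.
  have eFy : F j (act g y) = gact (gm_action W) g (F j y) := eF g y.
  by rewrite mxE eFy module_rep_col !mxE; apply: eq_bigr => l _; rewrite !mxE.
pose A := prodGVariety Y (module_gvariety W).
pose B := prodGVariety Y (module_gvariety (trivModule G d)).
pose phi (z : A) : B := (z.1, (invmx (M z.1) *m module_col z.2)^T).
pose psi (z : B) : A := (z.1, module_vec (M z.1 *m (z.2 : 'rV_d)^T)).
have phiK : cancel phi psi.
  by move=> [y w]; rewrite /psi /= trmxK mulKVmx // module_colK.
have psiK : cancel psi phi.
  by move=> [y c]; rewrite /phi /= module_vecK mulKmx // trmxK.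
exists phi, psi; split=> //.
- apply: (@pair_morphism k _ _ A).
    exact: (@fst_morphism k Y (module_gvariety W)).
  apply: rV_morphism => i j; rewrite [i]ord1.
  apply: (@eq_regular k A (fun z => (invmx (M z.1) *m module_col z.2) j ord0)).
    by move=> z; rewrite [RHS]mxE.
  apply: (@regular_mulmx k A) => a b.
    exact: (@fst_morphism k Y (module_gvariety W) _ (rIM a b)).
  exact: (@snd_morphism k Y (module_gvariety W) _ (@regular_module_col k G W a b)).
- apply: (@pair_morphism k _ _ B).
    exact: (@fst_morphism k Y (module_gvariety (trivModule G d))).
  apply: (@module_vec_morphism k G W B) => i.
  apply: (@regular_mulmx k B) => a b.
    exact: (@fst_morphism k Y (module_gvariety (trivModule G d)) _ (rM a b)).
  apply: (@eq_regular k B (fun z => (z.2 : 'rV_d) b a)).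
    by move=> z; rewrite [RHS]mxE.
  exact: (@snd_morphism k Y (module_gvariety (trivModule G d)) _ (@regular_rV_entry k d b a)).
- have psiE (g : G) z : psi (act g z) = act g (psi z).
    rewrite /psi; congr pair.
    have -> : (act g z).1 = act g z.1 by [].
    by rewrite ME -mulmxA module_vec_act.
  by move=> g z; rewrite -{1}[z]phiK -psiE psiK.
Qed.

Theorem closed_orbit_of_trivial_stabilizers :
  linearly_reductive G ->
  (exists f : relInvariant X, nonzero_fun f /\
     forall x : openGVariety f, stabilizer_acts_trivially (open_incl x) W) ->
  exists f : relInvariant X, nonzero_fun f /\
    exists x : openGVariety f,
      zariski_closed (gorbit x) /\ stabilizer_acts_trivially (open_incl x) W.
Proof.
move=> redG [f [[x0 fx0] triv]]; exists f; split; first by exists x0.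
have [x clx] := @exists_closed_orbit (openGVariety f) (exist _ x0 fx0) redG.
by exists x.
Qed.

Theorem covariants_of_closed_orbit :
  linearly_reductive G ->
  (exists f : relInvariant X, nonzero_fun f /\
    exists x : openGVariety f,
      zariski_closed (gorbit x) /\ stabilizer_acts_trivially (open_incl x) W) ->
  exists f : relInvariant X, nonzero_fun f /\
    exists F : 'I_d -> openGVariety f -> W,
      (forall i, covariant (F i)) /\
      (forall x : openGVariety f, free [tuple F i x | i < d]).
Proof.
move=> redG [f [_ [x [clx triv]]]].
have [|F cF Fx] := fin_all_exists2 (fun j : 'I_d =>
    closed_orbit_covariants redG clx _ (delta_mx j ord0)).
  move=> w i; apply: stabilizer_ideal_open.
  exact: (triv w (fun w => module_col w i ord0) (@regular_module_col k G W i ord0)).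
pose D y := \det (\matrix_(i, j) F j y i ord0).
have rD : regular D.
  apply: regular_det => i j; have [rF _] := cF j.
  by apply: eq_regular (rF i) => y; rewrite mxE.
have Dx : D x != 0.
  rewrite /D (_ : \matrix_(_, _) _ = 1%:M) ?det1 ?oner_neq0 //.
  by apply/matrixP => i j; rewrite !mxE Fx mxE eqxx andbT.
have [|f' [nf' [i [mi ei Di]]]] := semi_invariant_extends rD Dx det_character.
  by move=> g z; exact: det_covariants_act.
exists f'; split=> //; exists (fun j y => module_vec (F j (i y))); split.
  move=> j; have [rF eF] := cF j; split.
    apply: module_vec_morphism => l; exact: (mi _ (rF l)).
  by move=> g y; rewrite ei eF module_vec_act.
by move=> y; apply: free_module_vec; exact: Di.
Qed.

End Implications.

(** * Stabilizer ideals and fixed tangent vectors *)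

Section StabilizerIdeal.
Variables (k : closedFieldType) (G : algGroup k).
Local Notation GV := (group_variety G).

Lemma stabilizer_idealP (Y : gVariety G) (x : Y) :
  @function_ideal k GV (stabilizer_ideal x).
Proof.
split.
- exists 0%N, (fun _ _ => 0), (fun _ _ => 0); split=> [i|i|g]; last by rewrite big_ord0.
    exact: regular_cst.
  exact: regular_cst.
- move=> f1 f2 [m [a [h [ra rh E]]]] [m' [a' [h' [ra' rh' E']]]].
  exists (m + m')%N, (fun i => match split i with inl j => a j | inr j => a' j end),
    (fun i => match split i with inl j => h j | inr j => h' j end).
  split=> [i|i|g]; [by case: (split i)|by case: (split i)|].
  rewrite E E' big_split_ord; congr (_ + _); apply: eq_bigr => i _.
    by rewrite (unsplitK (inl i)).
  by rewrite (unsplitK (inr i)).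
- move=> b f1 rb [m [a [h [ra rh E]]]]; exists m, (fun i g => b g * a i g), h.
  split=> // [i|g]; first exact: (@regularM k GV).
  by rewrite E mulr_sumr; apply: eq_bigr => i _; rewrite mulrA.
Qed.

Lemma stabilizer_ideal_gen (Y : gVariety G) (x : Y) (h : Y -> k) : regular h ->
  stabilizer_ideal x (fun g => h (act g x) - h x).
Proof.
move=> rh; exists 1%N, (fun _ _ => 1), (fun _ => h); split=> // [_|g].
  exact: regular_cst.
by rewrite big_ord1 mul1r.
Qed.

Lemma function_ideal_sum (X : affVariety k) (J : (X -> k) -> Prop) n (F : 'I_n -> X -> k) :
  function_ideal J -> (forall i, J (F i)) -> J (fun x => \sum_i F i x).
Proof.
move=> [J0 JD _] JF; elim: n F JF => [|n IH] F JF.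
  have -> // : (fun x => \sum_i F i x) = fun _ => 0.
  apply: functional_extensionality => x. by rewrite big_ord0.
have -> : (fun x => \sum_i F i x) = fun x => F ord0 x + \sum_i F (lift ord0 i) x.
  by apply: functional_extensionality => x; rewrite big_ord_recl.
by apply: JD => //; apply: IH.
Qed.

(** All comparisons between stabilizers go through this universal property. *)
Lemma stabilizer_ideal_min (Y : gVariety G) (x : Y) (J : (G -> k) -> Prop) phi :
  @function_ideal k GV J ->
  (forall h, regular h -> J (fun g => h (act g x) - h x)) ->
  stabilizer_ideal x phi -> J phi.
Proof.
move=> JI Jgen [n [a [h [ra rh E]]]]; have [_ _ JM] := JI.
have -> : phi = fun g => \sum_i a i g * (h i (act g x) - h i x).
  exact: functional_extensionality.
by apply: (@function_ideal_sum GV) => // i; apply: JM => //; exact: Jgen.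
Qed.

Lemma stabilizer_ideal_morphism (Y Z : gVariety G) (eta : Y -> Z) (y : Y) phi :
  morphism eta -> equivariant eta ->
  stabilizer_ideal (eta y) phi -> stabilizer_ideal y phi.
Proof.
move=> mE eE; apply: stabilizer_ideal_min; first exact: stabilizer_idealP.
move=> h rh; have := stabilizer_ideal_gen y (mE h rh).
congr (stabilizer_ideal _ _); apply: functional_extensionality => g.
by rewrite eE.
Qed.

(** A regular function on X_f is a quotient u = v / f^m.  The difference
    u (g x) - u x is a combination of those of v and f^m, with coefficients that
    are regular in g because f does not vanish at g x. *)
Lemma stabilizer_ideal_of_open (X : gVariety G) (f : relInvariant X)
    (x : openGVariety f) phi :
  stabilizer_ideal x phi -> stabilizer_ideal (open_incl x) phi.
Proof.
have [J0 JD JM] := stabilizer_idealP (open_incl x).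
apply: stabilizer_ideal_min; first exact: stabilizer_idealP.
move=> u ru; have [m [v [rv vE]]] := clear_denominators ru.
pose fm y := f y ^+ m; have rfm : regular fm by apply: regularX; exact: relinv_regular.
have fm0 g : fm (act g (open_incl x)) != 0 by rewrite expf_neq0 // (svalP (act g x)).
pose q g := (fm (act g (open_incl x)))^-1.
have rq : @regular k GV q.
  by apply: (@regular_inv k GV) => //; exact: (regular_orbit_map (open_incl x) rfm).
have uE g : u (act g x) = q g * v (act g (open_incl x)).
  by rewrite /q -[v _](vE (act g x)) mulrC mulfK //; exact: fm0.
have fmx0 : fm (open_incl x) != 0 by rewrite expf_neq0 // (svalP x).
have ux : u x * fm (open_incl x) = v (open_incl x) by exact: (vE x).
have := JD _ _ (JM q _ rq (stabilizer_ideal_gen (open_incl x) rv))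
  (JM (fun g => - u x * q g) _ _ (stabilizer_ideal_gen (open_incl x) rfm)).
move=> /(_ (@regularZ k GV _ _ rq)); congr (stabilizer_ideal _ _).
apply: functional_extensionality => g; rewrite uE -ux.
rewrite !mulrBr -!mulrA mulVf ?fm0 // mulr1 !mulNr opprK.
rewrite [q g * (u x * _)]mulrCA -addrA; congr (_ + _).
by rewrite addrCA addNr addr0.
Qed.

End StabilizerIdeal.

Section Tangent.
Variables (k : closedFieldType) (G : algGroup k).
Local Notation GV := (group_variety G).
Variable J : (G -> k) -> Prop.
Hypothesis JI : @function_ideal k GV J.

Definition derivation (Z : affVariety k) (z : Z) (D : (Z -> k) -> k) : Prop :=
  [/\ forall f g, regular f -> regular g -> D (fun x => f x + g x) = D f + D g,
      forall c f, regular f -> D (fun x => c * f x) = c * D f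
    & forall f g, regular f -> regular g ->
        D (fun x => f x * g x) = f z * D g + D f * g z].

(** A tangent vector at z fixed by the subgroup scheme of G with ideal J.  The
    ideal is not tied to z, so that tangent vectors can be moved along morphisms
    without changing the subgroup. *)
Definition fixed_derivation (Z : gVariety G) (z : Z) (D : (Z -> k) -> k) : Prop :=
  derivation z D /\
  forall h, regular h -> J (fun g => D (fun y => h (act g y)) - D h).

Definition independent_derivations (Z : gVariety G) (z : Z) (r : nat) : Prop :=
  exists D : 'I_r -> (Z -> k) -> k, (forall i, fixed_derivation z (D i)) /\
    forall c : 'rV[k]_r, (forall h, regular h -> \sum_i c ord0 i * D i h = 0) -> c = 0.

Lemma derivation_cst (Z : affVariety k) (z : Z) D c : derivation z D -> D (fun _ => c) = 0.
Proof.
move=> [_ DZ DM]; have D1 : D (fun _ => 1) = 0.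
  have := DM (fun _ => 1) (fun _ => 1) (regular_cst Z 1) (regular_cst Z 1).
  rewrite !mulr1 mul1r => e.
  by apply: (@addIr _ (D (fun _ => 1))); rewrite add0r -e.
rewrite -[RHS](mulr0 c) -D1 -DZ; last exact: regular_cst.
by congr D; apply: functional_extensionality => x; rewrite mulr1.
Qed.

Lemma derivation_eq0 (Z : affVariety k) (z : Z) D : derivation z D ->
  (forall i, D (fun x => point_coord x i) = 0) -> forall h, regular h -> D h = 0.
Proof.
move=> dD D0 h [p pE]; have -> : h = fun x => p.@[point_coord x].
  exact: functional_extensionality.
have [DD DZ DM] := dD.
have [] // : regular (fun x : Z => p.@[point_coord x]) /\ D (fun x => p.@[point_coord x]) = 0.
apply: (@meval_closed k Z (fun h => regular h /\ D h = 0) _ (fun i x => point_coord x i)).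
- by move=> c; split; [exact: regular_cst|exact: derivation_cst dD].
- move=> f g [rf f0] [rg g0]; split; first exact: regularD.
  by rewrite DD // f0 g0 addr0.
- move=> f g [rf f0] [rg g0]; split; first exact: regularM.
  by rewrite DM // f0 g0 mulr0 mul0r addr0.
- by move=> i; split; [exact: regular_coord|exact: D0].
Qed.

Lemma derivation_sum (Z : affVariety k) (z : Z) D n (c : 'I_n -> k) (f : 'I_n -> Z -> k) :
  derivation z D -> (forall i, regular (f i)) ->
  D (fun x => \sum_i c i * f i x) = \sum_i c i * D (f i).
Proof.
move=> dD rf; have [DD DZ _] := dD; elim: n c f rf => [|n IH] c f rf.
  rewrite big_ord0 -[RHS](derivation_cst 0 dD); congr D.
  apply: functional_extensionality => x. by rewrite big_ord0.
rewrite big_ord_recl -IH // -DZ // -DD.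
- congr D; apply: functional_extensionality => x; exact: big_ord_recl.
- exact: regularZ.
- by apply: regular_sum => i; apply: regularZ.
Qed.

Lemma derivation_comb (Z : affVariety k) (z : Z) r (c : 'I_r -> k)
    (D : 'I_r -> (Z -> k) -> k) :
  (forall i, derivation z (D i)) -> derivation z (fun h => \sum_i c i * D i h).
Proof.
move=> dD; split=> [f g rf rg|a f rf|f g rf rg].
- rewrite -big_split; apply: eq_bigr => i _ /=.
  by have [-> // _ _] := dD i; rewrite mulrDr.
- rewrite mulr_sumr; apply: eq_bigr => i _.
  by have [_ -> // _] := dD i; rewrite mulrCA.
- rewrite mulr_sumr mulr_suml -big_split; apply: eq_bigr => i _ /=.
  by have [_ _ -> //] := dD i; rewrite mulrDr mulrCA; congr (_ + _); rewrite mulrA.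
Qed.

Lemma function_ideal_comb n (F : 'I_n -> G -> k) (c : 'I_n -> k) : (forall i, J (F i)) ->
  J (fun g => \sum_i c i * F i g).
Proof.
move=> JF; have [_ _ JM] := JI.
by apply: (@function_ideal_sum k GV) => // i; apply: JM => //; exact: regular_cst.
Qed.

Lemma fixed_derivation_comb (Z : gVariety G) (z : Z) r (c : 'I_r -> k)
    (D : 'I_r -> (Z -> k) -> k) :
  (forall i, fixed_derivation z (D i)) -> fixed_derivation z (fun h => \sum_i c i * D i h).
Proof.
move=> fD; split; first by apply: derivation_comb => i; case: (fD i).
move=> h rh; have := function_ideal_comb c (fun i => proj2 (fD i) h rh); congr J.
apply: functional_extensionality => g; rewrite -sumrB; apply: eq_bigr => i _.
by rewrite mulrBr.
Qed.

Lemma fixed_derivation_push (Y Z : gVariety G) (eta : Y -> Z) y D :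
  morphism eta -> equivariant eta -> fixed_derivation y D ->
  fixed_derivation (eta y) (fun h => D (fun x => h (eta x))).
Proof.
move=> mE eE [[DD DZ DM] fD]; split; first split.
- by move=> f g rf rg; apply: DD; exact: mE.
- by move=> c f rf; apply: DZ; exact: mE.
- by move=> f g rf rg; apply: DM; exact: mE.
move=> h rh; have := fD _ (mE h rh); congr J; apply: functional_extensionality => g.
by congr (D _ - _); apply: functional_extensionality => x; rewrite eE.
Qed.

Lemma independent_derivations_bound (Z : gVariety G) (z : Z) r :
  independent_derivations z r -> (r <= adim (aff_structure Z))%N.
Proof.
move=> [D [fD ind]].
pose A := \matrix_(i < r, j < adim (aff_structure Z)) D i (fun x => point_coord x j).
suff /eqP <- : row_free A by exact: rank_leq_col.
apply: inj_row_free => c cA; apply: ind => h rh.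
apply: (@derivation_eq0 _ z (fun h => \sum_i c ord0 i * D i h)) => //.
  by apply: derivation_comb => i; case: (fD i).
move=> j; have /rowP/(_ j) := cA; rewrite !mxE => e; rewrite -[RHS]e.
by apply: eq_bigr => i _; rewrite mxE.
Qed.

End Tangent.

Section Slope.
Variables (k : closedFieldType) (G : algGroup k) (Y : gVariety G) (d : nat).
Local Notation GV := (group_variety G).
Local Notation Z := (prodGVariety Y (module_gvariety (trivModule G d))).
Variables (x : Y) (c : 'rV[k]_d) (j : 'I_d).

(** The affine line through (y, c) in the direction of the j-th coordinate. *)
Definition line (y : Y) (s : k) : Z := (y, c + s *: delta_mx ord0 j).

Lemma poly_ext (P Q : {poly k}) : (forall s, P.[s] = Q.[s]) -> P = Q.
Proof.
move=> PQ; apply/eqP; rewrite -subr_eq0; apply/negPn/negP => /poly_nonroot[s].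
by rewrite !hornerE PQ subrr eqxx.
Qed.

Lemma regular_line_poly (b : 'rV[k]_d -> k) :
  regular (b : vectVariety ('rV[k]_d : vectType k) -> k) ->
  exists P : {poly k}, forall s, b (c + s *: delta_mx ord0 j) = P.[s].
Proof.
move=> [p pE].
have -> : b = fun v => p.@[@point_coord _ (vectVariety ('rV[k]_d : vectType k)) v].
  exact: functional_extensionality.
apply: (@meval_closed k 'rV[k]_d (fun b => exists P : {poly k},
  forall s, b (c + s *: delta_mx ord0 j) = P.[s]) _
  (fun i v => @point_coord _ (vectVariety ('rV[k]_d : vectType k)) v i)).
- by move=> a; exists a%:P => s; rewrite hornerC.
- by move=> f g [P PE] [Q QE]; exists (P + Q) => s; rewrite hornerD PE QE.
- by move=> f g [P PE] [Q QE]; exists (P * Q) => s; rewrite hornerM PE QE.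
- move=> i; pose l v := coord (vbasis {: 'rV[k]_d}) i v.
  exists ((l c)%:P + (l (delta_mx ord0 j)) *: 'X) => s.
  rewrite hornerD hornerZ hornerC hornerX.
  have -> : forall v, @point_coord _ (vectVariety ('rV[k]_d : vectType k)) v i = l v by [].
  by rewrite /l linearD linearZ /= mulrC.
Qed.

Lemma regular_line_family (u : Z -> k) : regular u ->
  exists (K : finType) (a : K -> Y -> k) (P : K -> {poly k}),
    (forall i, regular (a i)) /\ forall y s, u (line y s) = (\sum_i a i y *: P i).[s].
Proof.
move=> /regular_prodP[K [a [b [ra rb E]]]].
have [P PE] := fin_all_exists (fun i => regular_line_poly (rb i)).
exists K, a, P; split=> // y s; rewrite /line E horner_sum.
by apply: eq_bigr => i _; rewrite hornerZ PE.
Qed.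

(** The derivative of u at (x, c) along [line].  It is the coefficient of degree
    1 of the polynomial s |-> u (line x s), which is unique because k is
    infinite. *)
Definition slope (u : Z -> k) : k :=
  epsilon (inhabits 0) (fun e => exists2 P : {poly k}, forall s, u (line x s) = P.[s] & e = P`_1).

Lemma slopeE u (P : {poly k}) : (forall s, u (line x s) = P.[s]) -> slope u = P`_1.
Proof.
move=> uP; rewrite /slope; have [|Q uQ ->] := epsilon_spec (inhabits 0)
    (fun e => exists2 P : {poly k}, forall s, u (line x s) = P.[s] & e = P`_1).
  by exists P`_1, P.
by rewrite (@poly_ext Q P) // => s; rewrite -uQ -uP.
Qed.

Lemma regular_line (u : Z -> k) : regular u ->
  exists P : {poly k}, forall s, u (line x s) = P.[s].
Proof. by move=> /regular_line_family[K [a [P [_ E]]]]; exists (\sum_i a i x *: P i). Qed.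

Lemma slope_derivation : derivation (line x 0) slope.
Proof.
split=> [f g /regular_line[P fP] /regular_line[Q gQ]|a f /regular_line[P fP]
        |f g /regular_line[P fP] /regular_line[Q gQ]].
- rewrite (slopeE fP) (slopeE gQ) -coefD; apply: slopeE => s.
  by rewrite hornerD fP gQ.
- rewrite (slopeE fP) -coefZ; apply: slopeE => s; by rewrite hornerZ fP.
- rewrite (slopeE fP) (slopeE gQ) fP gQ !horner_coef0.
  rewrite (slopeE (P := P * Q)); last by move=> s; rewrite hornerM fP gQ.
  by rewrite coefM big_ord_recl big_ord1.
Qed.

(** G acts trivially on k^d, and the derivative of u at (y, c) is a regular
    function of y. *)
Lemma slope_fixed (J : (G -> k) -> Prop) :
  (forall h, regular h -> J (fun g => h (act g x) - h x)) ->
  fixed_derivation J (line x 0) slope.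
Proof.
move=> Jx; split; first exact: slope_derivation.
move=> u /regular_line_family[K [a [P [ra uE]]]].
pose v y := \sum_i a i y * (P i)`_1.
have vE y : v y = (\sum_i a i y *: P i)`_1.
  by rewrite coef_sum; apply: eq_bigr => i _; rewrite coefZ.
have rv : regular v.
  by apply: regular_sum => i; apply: regularM => //; exact: regular_cst.
have := Jx v rv; congr J; apply: functional_extensionality => g.
rewrite (slopeE (uE x)) -vE (slopeE (P := \sum_i a i (act g x) *: P i)) -?vE // => s.
exact: (uE (act g x) s).
Qed.

Lemma slope_snd i : slope (fun z => (z.2 : 'rV[k]_d) ord0 i) = (i == j)%:R.
Proof.
rewrite (slopeE (P := (c ord0 i)%:P + (i == j)%:R *: 'X)).
  by rewrite coefD coefC coefZ coefX mulr1 add0r.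
by move=> s; rewrite hornerD hornerC hornerZ hornerX /= !mxE eqxx mulrC.
Qed.

End Slope.

(** * Tangent vectors and trivializations *)

Section Trivialization.
Variables (k : closedFieldType) (G : algGroup k) (Y : gVariety G) (W : gModule G).
Local Notation GV := (group_variety G).
Local Notation d := (\dim {:W}).
Local Notation A := (prodGVariety Y (module_gvariety W)).
Local Notation B := (prodGVariety Y (module_gvariety (trivModule G d))).

(** The vectors of W, in coordinates, fixed by the subgroup scheme with ideal
    J. *)
Definition fixes (J : (G -> k) -> Prop) (m : 'cV[k]_d) : Prop :=
  forall i, J (fun g => (module_rep W g *m m) i ord0 - m i ord0).

Lemma function_ideal_fixes (J : (G -> k) -> Prop) : @function_ideal k GV J ->
  (forall m, fixes J m) -> forall (w : module_gvariety W) (h : module_gvariety W -> k), regular h ->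
  J (fun g => h (act g w) - h w).
Proof.
move=> JI fix_ w h [p pE]; have [J0 JD JM] := JI.
have -> : h = fun v => p.@[@point_coord _ (module_gvariety W) v].
  exact: functional_extensionality.
pose P (h : module_gvariety W -> k) := regular h /\ J (fun g => h (act g w) - h w).
suff [] : P (fun v => p.@[@point_coord _ (module_gvariety W) v]) by [].
apply: (@meval_closed k (module_gvariety W) P _
  (fun i v => @point_coord _ (module_gvariety W) v i)).
- move=> c; split; first exact: regular_cst.
  by have := J0; congr J; apply: functional_extensionality => g; rewrite subrr.
- move=> f g [rf Jf] [rg Jg]; split; first exact: regularD.
  have := JD _ _ Jf Jg; congr J; apply: functional_extensionality => s.
  by rewrite opprD addrACA.
- move=> f g [rf Jf] [rg Jg]; split; first exact: regularM.
  have := JD _ _ (JM _ _ (regular_orbit_map w rf) Jg)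
    (JM (fun _ => g w) _ (regular_cst _ _) Jf).
  congr J; apply: functional_extensionality => s.
  by rewrite !mulrBr addrA [g w * _]mulrC subrK [g w * _]mulrC.
- move=> i; split; first exact: regular_coord.
  have := fix_ (module_col w) i; congr J; apply: functional_extensionality => g.
  by rewrite -module_rep_col !mxE.
Qed.

Lemma zero_section_equivariant : @equivariant k G Y A (fun y => (y, 0 : W)).
Proof.
have e g : gact (gm_action W) g (0 : W) = 0.
  apply: (can_inj (@module_colK k G W)); rewrite module_rep_col.
  rewrite (_ : module_col _ = 0) ?mulmx0 //.
  by apply/colP => i; rewrite !mxE linear0.
by move=> g y; congr pair; exact: (esym (e g)).
Qed.

Lemma cst_section_equivariant c : @equivariant k G Y B (fun y => (y, c)).
Proof. by []. Qed.

Variables (phi : A -> B) (psi : B -> A).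
Hypotheses (phiK : cancel phi psi) (psiK : cancel psi phi).
Hypotheses (mphi : morphism phi) (mpsi : morphism psi) (ephi : equivariant phi).

Lemma inverse_equivariant : equivariant psi.
Proof. by move=> g z; rewrite -{1}[z]psiK -ephi phiK. Qed.

(** The r vectors at x' and the d directions of k^d give r + d independent
    tangent vectors at (x', c), which psi moves to (x, 0).  Their components in
    W are fixed, hence span a proper subspace of W because m0 is not fixed.  So
    at least r + 1 independent combinations have no component in W; these are
    tangent vectors of Y at x. *)
Lemma tangent_step (J : (G -> k) -> Prop) x x' c m0 r :
  @function_ideal k GV J -> (forall h, regular h -> J (fun g => h (act g x') - h x')) ->
  phi (x, 0) = (x', c) -> ~ fixes J m0 -> independent_derivations J x' r ->
  exists2 s, (r < s)%N & independent_derivations J x s.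
Proof.
move=> JI Jx' phix nfix [D [fD indD]].
have [J0 JD JM] := JI.
have psix : psi (x', c) = (x, 0) by rewrite -phix phiK.
pose E (a : 'I_(r + d)) : (B -> k) -> k := match split a with
  | inl i => fun h => D i (fun y => h (y, c))
  | inr j => slope x' c j end.
have fE a : fixed_derivation J ((x', c) : B) (E a).
  rewrite /E; case: (split a) => [i|j].
    apply: (@fixed_derivation_push _ _ _ Y B (fun y => (y, c))) => //.
      exact: (@morphism_pairl k Y (module_gvariety (trivModule G d))).
  have -> : ((x', c) : B) = line c j x' 0 by rewrite /line scale0r addr0.
  exact: slope_fixed.
pose T a : (A -> k) -> k := fun h => E a (fun z => h (psi z)).
have fT a : fixed_derivation J ((x, 0) : A) (T a).
  by rewrite -psix; apply: fixed_derivation_push => //; exact: inverse_equivariant.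
pose M := \matrix_(a < r + d, i < d) T a (fun z => module_col z.2 i ord0).
have rcol i : regular (fun z : A => module_col z.2 i ord0).
  exact: (@snd_morphism k Y (module_gvariety W) _ (@regular_module_col k G W i ord0)).
have fixM a : fixes J (row a M)^T.
  move=> i; have [[TD TZ TM] Tfix] := fT a.
  have := Tfix _ (rcol i); congr J; apply: functional_extensionality => g.
  congr (_ - _); last by rewrite !mxE.
  have -> : (fun y : A => module_col (act g y : A).2 i ord0) =
      fun y : A => \sum_l module_rep W g i l * module_col y.2 l ord0.
    apply: functional_extensionality => y.
    have -> : module_col (act g y : A).2 = module_rep W g *m module_col y.2.
      exact: module_rep_col.
    by rewrite mxE.
  rewrite (derivation_sum _ (proj1 (fT a)) (fun l => rcol l)) [RHS]mxE.
  apply: eq_bigr => l _; rewrite [X in _ = _ * X]mxE [X in _ = _ * X]mxE.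
  by rewrite [X in _ = _ * X]mxE.
have nfullM : ~~ row_full M.
  apply/negP => /row_fullP[L LM]; apply: nfix => i.
  have mE : m0 = \sum_a (m0^T *m L) ord0 a *: (row a M)^T.
    apply: trmx_inj; rewrite linear_sum /= -[LHS]mulmx1 -LM mulmxA mulmx_sum_row.
    by apply: eq_bigr => a _; rewrite linearZ /= trmxK.
  have := function_ideal_comb JI (fun a => (m0^T *m L) ord0 a) (fun a => fixM a i).
  congr J; apply: functional_extensionality => g.
  rewrite [in RHS]mE mulmx_sumr !summxE -sumrB; apply: eq_bigr => a _.
  by rewrite -scalemxAr mulrBr; congr (_ - _); rewrite [RHS]mxE.
(* Combinations of the T a without component in W. *)
pose K := row_base (kermx M).
exists (\rank (kermx M)).
  rewrite mxrank_ker ltn_subRL [X in (X < _)%N]addnC ltn_add2l.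
  by rewrite ltn_neqAle rank_leq_col andbT.
exists (fun b h => \sum_a K b a * T a (fun z => h z.1)); split.
  move=> b; have := @fixed_derivation_comb _ _ J JI Y x (r + d) (fun a => K b a)
     (fun a h => T a (fun z => h z.1)).
  apply=> a.
  apply: (@fixed_derivation_push _ _ _ A Y fst (x, 0)) => //.
  exact: (@fst_morphism k Y (module_gvariety W)).
move=> q q0; pose t := q *m K.
have tM : t *m M = 0.
  have /sub_kermxP KM : (K <= kermx M)%MS by rewrite eq_row_base.
  by rewrite -mulmxA KM mulmx0.
have dt : derivation ((x, 0) : A) (fun h => \sum_a t ord0 a * T a h).
  by apply: derivation_comb => a; case: (fT a).
have t0 (h : A -> k) : regular h -> \sum_a t ord0 a * T a h = 0.
  apply: (derivation_eq0 dt) => i; rewrite -(splitK i); case: (split i) => l /=.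
    have rl : regular (fun y : Y => point_coord y l) by exact: regular_coord.
    rewrite -[RHS](q0 _ rl).
    have -> : (fun z : A => point_coord z (lshift _ l)) = fun z => point_coord z.1 l.
      by apply: functional_extensionality => z; exact: prod_point_coordl.
    under [RHS]eq_bigr => b _ do rewrite mulr_sumr.
    rewrite exchange_big; apply: eq_bigr => a _ /=.
    by rewrite mxE mulr_suml; apply: eq_bigr => b _; rewrite mulrA.
  have -> : (fun z : A => point_coord z (rshift _ l)) = fun z => module_col z.2 l ord0.
    apply: functional_extensionality => z; rewrite [RHS]mxE; exact: prod_point_coordr.
  have /rowP/(_ l) := tM; rewrite [in RHS]mxE => e; rewrite -[RHS]e mxE.
  by apply: eq_bigr => a _; rewrite [X in _ = _ * X]mxE.
have t0B (u : B -> k) : regular u -> \sum_a t ord0 a * E a u = 0.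
  move=> ru; rewrite -[RHS](t0 _ (mphi ru)); apply: eq_bigr => a _; congr (_ * _).
  by congr (E a); apply: functional_extensionality => z; rewrite psiK.
have El i : E (lshift d i) = fun h => D i (fun y => h (y, c)).
  by rewrite /E (unsplitK (inl i)).
have Er j : E (rshift r j) = slope x' c j by rewrite /E (unsplitK (inr j)).
have tr j : t ord0 (rshift r j) = 0.
  have rj : @regular k B (fun z => (z.2 : 'rV[k]_d) ord0 j).
    exact: (@snd_morphism k Y (module_gvariety (trivModule G d)) _ (@regular_rV_entry k d ord0 j)).
  rewrite -[RHS](t0B _ rj) big_split_ord /= big1 ?add0r => [|i _]; last first.
    by rewrite El (derivation_cst _ (proj1 (fD i))) mulr0.
  rewrite (bigD1 j) //= big1 ?addr0 => [|i /negbTE ni]; last first.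
    by rewrite Er slope_snd eq_sym ni mulr0.
  by rewrite Er slope_snd eqxx mulr1.
have tl : lsubmx t = 0.
  apply: indD => h rh.
  have rh1 : @regular k B (fun z => h z.1).
    exact: (@fst_morphism k Y (module_gvariety (trivModule G d)) _ rh).
  rewrite -[RHS](t0B _ rh1) big_split_ord /= [X in _ + X]big1 ?addr0 => [|j _]; last first.
    by rewrite tr mul0r.
  by apply: eq_bigr => i _; rewrite mxE El.
have t00 : t = 0.
  apply/rowP => a; rewrite [RHS]mxE -(splitK a); case: (split a) => [i|j] /=; last exact: tr.
  by have /rowP/(_ i) := tl; rewrite [LHS]mxE [RHS]mxE.
apply: (row_free_inj (row_base_free (kermx M))).
by rewrite mul0mx.
Qed.

(** Both y |-> (phi (y, 0)).1 and y |-> (psi (y, c)).1 are equivariant, and for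
    phi (x, 0) = (x', c) they exchange x and x'. *)
Lemma stabilizer_trivialization (x : Y) phi0 :
  stabilizer_ideal (phi (x, 0)).1 phi0 <-> stabilizer_ideal x phi0.
Proof.
split.
  apply: (@stabilizer_ideal_morphism _ _ Y Y (fun y => (phi (y, 0)).1) x).
    move=> h rh; exact: (morphism_pairl (Y := module_gvariety W) (0 : W)
      (mphi (@fst_morphism k Y (module_gvariety (trivModule G d)) _ rh))).
  by move=> g y; rewrite zero_section_equivariant ephi.
case E: (phi (x, 0)) => [x' c] /=.
have {1}-> : x = (psi (x', c)).1 by rewrite -E phiK.
apply: (@stabilizer_ideal_morphism _ _ Y Y (fun y => (psi (y, c)).1) x').
  move=> h rh; exact: (morphism_pairl (Y := module_gvariety (trivModule G d)) c
    (mpsi (@fst_morphism k Y (module_gvariety W) _ rh))).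
by move=> g y; rewrite cst_section_equivariant inverse_equivariant.
Qed.

(** Induction on n, from x' with phi (x, 0) = (x', c) to x.  The ideal J remains
    the same by [stabilizer_trivialization]. *)
Lemma many_tangent_vectors (J : (G -> k) -> Prop) m0 n (x : Y) :
  (forall phi0, J phi0 <-> stabilizer_ideal x phi0) -> ~ fixes J m0 ->
  exists2 s, (n <= s)%N & independent_derivations J x s.
Proof.
move=> Jx nfix; have JI : @function_ideal k GV J.
  have -> : J = stabilizer_ideal x; last exact: stabilizer_idealP.
  by apply: functional_extensionality => f; apply: propositional_extensionality.
elim: n x Jx => [|n IH] x Jx.
  exists 0%N => //; exists (fun _ _ => 0); split=> [[]//|q _].
  by apply/rowP => -[].
case E: (phi (x, 0)) => [x' c].
have Jx' phi0 : J phi0 <-> stabilizer_ideal x' phi0.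
  by apply: (iff_trans (Jx phi0)); have := stabilizer_trivialization x phi0; rewrite E => -[].
have [s ns inds] := IH x' Jx'.
have gen h : regular h -> J (fun g => h (act g x') - h x').
  by move=> rh; apply/Jx'; exact: stabilizer_ideal_gen.
have [s' ss' inds'] := tangent_step JI gen E nfix inds.
by exists s' => //; exact: leq_trans ss'.
Qed.

Lemma stabilizer_trivial_of_trivialization (x : Y) (w : module_gvariety W)
    (h : module_gvariety W -> k) :
  regular h -> stabilizer_ideal x (fun g => h (act g w) - h w).
Proof.
apply: (function_ideal_fixes (stabilizer_idealP x)) => m; apply: NNPP => nfix.
have [s ss inds] := many_tangent_vectors (adim (aff_structure Y)).+1
  (fun phi0 => iff_refl (stabilizer_ideal x phi0)) nfix.
by have := independent_derivations_bound inds; rewrite leqNgt ss.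
Qed.

End Trivialization.

Theorem corollary3p6 (k : closedFieldType) (G : algGroup k)
    (X : gVariety G) (W : gModule G) :
  linearly_reductive G -> irreducible X ->
  let d : nat := \dim {:W} in
  [<-> exists f : relInvariant X,
         nonzero_fun f /\
         forall x : openGVariety f, stabilizer_acts_trivially (open_incl x) W;
       exists f : relInvariant X,
         nonzero_fun f /\
         exists x : openGVariety f,
           zariski_closed (gorbit x) /\ stabilizer_acts_trivially (open_incl x) W;
       exists f : relInvariant X,
         nonzero_fun f /\
         exists F : 'I_d -> openGVariety f -> W,
           (forall i, covariant (F i)) /\
           (forall x : openGVariety f, free [tuple F i x | i < d]);
       exists f : relInvariant X,
         nonzero_fun f /\
         gisomorphic
           (prodGVariety (openGVariety f) (module_gvariety W))
           (prodGVariety (openGVariety f) (module_gvariety (trivModule G d)))].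
Proof.
move=> redG _ d; tfae.
- exact: closed_orbit_of_trivial_stabilizers.
- exact: covariants_of_closed_orbit.
- move=> [f [nf [F [cF fF]]]]; exists f; split=> //.
  exact: covariants_trivialize cF fF.
- move=> [f [nf [phi [psi [phiK psiK mphi mpsi ephi]]]]]; exists f; split=> // x w h rh.
  apply: stabilizer_ideal_of_open.
  exact: (stabilizer_trivial_of_trivialization phiK psiK mphi mpsi ephi x w rh).
Qed.
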